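(* Let $\mathcal{G}$ be a locally finite p.m.p. Borel graph on a standard probability space $(X,\mu)$. (1) $\mathcal{G}$ is $\mu$-hyperfinite if and only if for every $\epsilon>0$ there exists a Borel complete section $A\subseteq X$ for $\mathcal{R}_{\mathcal{G}}$ with $\mu(A)>1-\epsilon$ such that $\mathcal{G}_{\restriction A}$ has finite connected components. (2) $\mathcal{G}$ is $\mu$-nowhere hyperfinite if and only if for every $\epsilon>0$ there exists a Borel complete section $A\subseteq X$ for $\mathcal{R}_{\mathcal{G}}$ with $\mu(A)<\epsilon$ such that $\mathcal{G}_{\restriction A}$ is $\mu_{\restriction A}$-nowhere hyperfinite.
   Context: $\mathcal{R}_{\mathcal{G}}$ is the connectedness equivalence relation of the Borel graph $\mathcal{G}$ on $X$; $\mathcal{G}$ is p.m.p. if $\mu$ is $\mathcal{R}_{\mathcal{G}}$-invariant. $\mathcal{G}_{\restriction A}$ is the induced subgraph on $A$. A complete section for $\mathcal{R}_{\mathcal{G}}$ is a set meeting every $\mathcal{R}_{\mathcal{G}}$-class. A Borel equivalence relation is hyperfinite if it is an increasing union of a sequence of Borel equivalence relations with finite classes. $\mathcal{G}$ is $\mu$-hyperfinite if there is a $\mu$-conull Borel set $X_0\subseteq X$ such that $\mathcal{R}_{\mathcal{G}_{\restriction X_0}}$ is hyperfinite. $\mathcal{G}$ is $\mu$-nowhere hyperfinite if there is no Borel set $B\subseteq X$ of positive $\mu$-measure such that $(\mathcal{R}_{\mathcal{G}})_{\restriction B}$ is hyperfinite; similarly, $\mathcal{G}_{\restriction A}$ is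 $\mu_{\restriction A}$-nowhere hyperfinite if there is no Borel set $B\subseteq A$ of positive measure such that $(\mathcal{R}_{\mathcal{G}_{\restriction A}})_{\restriction B}$ is hyperfinite. *)

(* Defs.v *)
From Stdlib Require Import Relation_Operators.
From HB Require Import structures.
From mathcomp Require Import all_boot all_order all_algebra.
From mathcomp Require Import all_classical all_reals all_analysis.

Set Implicit Arguments.
Unset Strict Implicit.
Unset Printing Implicit Defensive.

Import Order.TTheory GRing.Theory Num.Theory.
Import numFieldNormedType.Exports.

Local Open Scope classical_set_scope.
Local Open Scope ring_scope.
Local Open Scope ereal_scope.

Definition polish (R : realType) (S : metricType R) : Prop :=
  (forall F : set_system S, ProperFilter F -> cauchy F -> exists x : S, F --> x) /\
  (exists2 D : set S, countable D & dense D).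

(* X is Borel isomorphic to a Polish space. *)
Definition standard_borel (R : realType) d (X : measurableType d) : Prop :=
  exists (S : metricType R) (f : X -> S),
    [/\ polish S, bijective f &
        forall A : set X, measurable A <-> <<s @open S >> (f @` A)].

Section graphs_and_relations.
Context {d : measure_display} {X : measurableType d}.
Implicit Types (A B Y : set X) (E G H : set (X * X)).

Definition borel_graph G : Prop :=
  [/\ measurable G, forall x, ~ G (x, x) & forall x y, G (x, y) -> G (y, x)].

Definition locally_finite G : Prop := forall x, finite_set [set y | G (x, y)].

(* Both the induced subgraph and the restriction of an equivalence relation. *)
Definition restr E A : set (X * X) := E `&` (A `*` A).

(* Here and below, a graph comes as a vertex set Y together with a symmetric
   edge set H included in Y `*` Y; the relation lives on Y, so that vertices
   outside of Y are related to nothing, not even to themselves. *)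
Definition conn_rel Y H : set (X * X) :=
  [set p | [/\ Y p.1, Y p.2 &
               clos_refl_trans X (fun x y => H (x, y)) p.1 p.2]].

Definition finite_components Y H : Prop :=
  forall x, Y x -> finite_set [set y | conn_rel Y H (x, y)].

Definition complete_section E A : Prop := forall x, exists2 y, A y & E (x, y).

Definition borel_equivalence Y E : Prop :=
  [/\ measurable E, E `<=` Y `*` Y, forall x, Y x -> E (x, x),
      forall x y, E (x, y) -> E (y, x) &
      forall x y z, E (x, y) -> E (y, z) -> E (x, z)].

Definition hyperfinite Y E : Prop :=
  borel_equivalence Y E /\
  exists F : nat -> set (X * X),
    [/\ forall n, borel_equivalence Y (F n),
        forall n x, finite_set [set y | F n (x, y)],
        forall n, F n `<=` F n.+1 &
        E = \bigcup_n F n].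

Context {R : realType} (mu : set X -> \bar R).

(* Invariance under the Borel partial bijections whose graph is included
   in E. *)
Definition invariant_measure E : Prop :=
  forall A B (f : X -> X), measurable A -> measurable B ->
    measurable_fun A f -> set_bij A B f -> (forall x, A x -> E (x, f x)) ->
    mu A = mu B.

Definition pmp G : Prop := invariant_measure (conn_rel setT G).

Definition mu_hyperfinite G : Prop :=
  exists X0 : set X, [/\ measurable X0, mu (~` X0) = 0 &
                         hyperfinite X0 (conn_rel X0 (restr G X0))].

Definition nowhere_hyperfinite Y H : Prop :=
  ~ exists B, [/\ measurable B, B `<=` Y, 0 < mu B &
                  hyperfinite B (restr (conn_rel Y H) B)].

End graphs_and_relations.

(* Main.v *)
Require Import Defs.
From Stdlib Require Import Relation_Operators.
From mathcomp Require Import all_boot all_order all_algebra.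
From mathcomp Require Import all_classical all_reals all_analysis.
From mathcomp Require Import ring lra.

(** Call a Borel set A almost finite when it has Borel subsets K, of measure
    arbitrarily close to that of A, on which G induces finite components.

    The first equivalence amounts to that of almost finite with hyperfinite up
    to a null set. If the relation of the induced graph is an increasing union
    of finite Borel relations F n, the points whose finitely many neighbours
    are all F n related to them form sets with finite components that exhaust
    the space; conversely, by Borel-Cantelli, approximations with summable
    errors have liminfs that exhaust almost everything
    ([almost_finite_hyperfinite]). The set K is made to meet every class by
    adding, in the classes that it misses, a Borel independent set that meets
    every class.

    In the second one, hyperfiniteness on a non-null set B passes, along a
    Borel partial injection inside the classes, to a non-null part of any
    complete section ([nowhere_section]). The main point is the construction of
    small sections. Every Borel set splits into a union of components that is
    almost finite and a nowhere hyperfinite rest ([nowhere_decomposition]), so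
    it is enough to work in a nowhere hyperfinite A0 of bounded degree D and to
    show that the infimum of the measures of the nowhere hyperfinite A included
    in A0 with the same saturation is 0 ([small_section]). If it is positive,
    take A within delta of it, and K included in A, with finite components and
    nearly the largest possible measure. Cut K into N pieces P i, each a union
    of components of K, with N >= 2 D; each vertex of A \ K is adjacent to at
    most D pieces. As A is nearly minimal, outside an invariant set W i, in
    which P i has measure at most delta, A \ P i is almost finite. There one
    can use P i, together with a set with finite components that nearly fills A
    \ P i, minus the neighbours of P i, as a competitor of K: hence A \ K is
    hardly larger than its set of neighbours of P i. Summing over i, A \ K is
    nearly null outside the union of the W i, so A is almost finite on an
    invariant set of measure bounded below, which contradicts that A is nowhere
    hyperfinite.

    The union of the W i must be small in this argument, so each P i has to
    carry the same proportion of K in every invariant set. This is obtained by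
    repeated halving ([half_types]): a Borel matching of points inside the
    classes, maximal among all pairs of equal type, leaves unmatched a set that
    is null, since in a nowhere hyperfinite graph no set of positive measure
    meets each class in at most one point, and invariance of the measure makes
    both sides of the matching equal in every invariant set.

    All constructions stay Borel because the neighbours of a point are listed
    by a sequence of Borel functions ([moves_exist]). This follows from the
    theorem that Borel sets with finite sections have Borel projections
    ([borelC_proj]), proved here for Cantor space from Novikov's separation
    theorem ([novikov]) and compactness, and transported to standard Borel
    spaces. *)

Set Implicit Arguments.
Unset Strict Implicit.
Unset Printing Implicit Defensive.
Import Order.TTheory GRing.Theory Num.Theory.
Import numFieldNormedType.Exports.
Local Open Scope classical_set_scope.

(** * Borel and analytic subsets of Cantor space *)

Definition agree (T : Type) (k : nat) (a b : nat -> T) :=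
  forall i, (i < k)%N -> a i = b i.

Lemma agree_le T k l (a b : nat -> T) : (l <= k)%N -> agree k a b -> agree l a b.
Proof. by move=> lk h i il; apply: h; exact: leq_trans lk. Qed.

(** An inductive presentation of the sigma-algebra generated by the
    coordinates, so that Borel sets can be treated by structural induction. *)
Inductive borelC : set (nat -> bool) -> Prop :=
| borelC_coord n : borelC [set z | z n]
| borelC_setC A : borelC A -> borelC (~` A)
| borelC_bigcup (F : nat -> set (nat -> bool)) :
    (forall n, borelC (F n)) -> borelC (\bigcup_n F n).

Lemma borelC_setU A B : borelC A -> borelC B -> borelC (A `|` B).
Proof.
move=> bA bB.
rewrite (_ : A `|` B = \bigcup_n (if n == 0%N then A else B)).
  by apply: borelC_bigcup => n; case: ifP.
apply/seteqP; split=> [z [Az|Bz]|z [n _]].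
- by exists 0%N.
- by exists 1%N.
- by case: ifP => _; [left|right].
Qed.

Lemma borelC_setI A B : borelC A -> borelC B -> borelC (A `&` B).
Proof.
move=> bA bB; rewrite -[X in borelC X]setCK setCI; apply: borelC_setC.
by apply: borelC_setU; exact: borelC_setC.
Qed.

Lemma borelC_setT : borelC setT.
Proof.
rewrite -(setUv [set z : nat -> bool | z 0%N]).
by apply: borelC_setU; [|apply: borelC_setC]; exact: borelC_coord.
Qed.

Lemma borelC_const (P : Prop) : borelC [set _ | P].
Proof.
have [p|np] := pselect P.
  rewrite (_ : [set _ | P] = setT); first exact: borelC_setT.
  by apply/seteqP; split.
rewrite (_ : [set _ | P] = ~` setT); first exact/borelC_setC/borelC_setT.
by rewrite setCT; apply/seteqP; split=> // z /np.
Qed.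

Lemma borelC_exists (I : countType) (F : I -> set (nat -> bool)) :
  (forall i, borelC (F i)) -> borelC [set z | exists i, F i z].
Proof.
move=> bF.
rewrite (_ : [set _ | _] =
  \bigcup_n (if unpickle n is Some i then F i else [set _ | False])).
  by apply: borelC_bigcup => n; case: unpickle => // *; exact: borelC_const.
apply/seteqP; split=> [z [i Fi]|z [n _]].
  by exists (pickle i) => //; rewrite pickleK.
by case: unpickle => // i; exists i.
Qed.

Lemma borelC_forall (I : countType) (F : I -> set (nat -> bool)) :
  (forall i, borelC (F i)) -> borelC [set z | forall i, F i z].
Proof.
move=> bF; rewrite (_ : [set _ | _] = ~` [set z | exists i, (~` F i) z]).
  by apply/borelC_setC/borelC_exists => i; exact: borelC_setC.
apply/seteqP; split=> [z h [i]|z /forallNP h i]; first by apply; exact: h.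
exact: contrapT (h i).
Qed.

Lemma borelC_imply (P Q : set (nat -> bool)) :
  borelC P -> borelC Q -> borelC [set z | P z -> Q z].
Proof.
move=> bP bQ; rewrite (_ : [set _ | _] = ~` P `|` Q).
  by apply: borelC_setU => //; exact: borelC_setC.
apply/seteqP; split=> [z h|z /= [nP Pz|Qz _]] //.
by have [/h|] := pselect (P z); [right|left].
Qed.

Lemma borelC_preimage (Phi : (nat -> bool) -> nat -> bool) B :
  (forall n, borelC [set z | Phi z n]) -> borelC B -> borelC (Phi @^-1` B).
Proof.
move=> bPhi; elim=> [n|A _ ih|F _ ih].
- exact: bPhi.
- by rewrite preimage_setC; exact: borelC_setC.
- by rewrite preimage_bigcup; exact: borelC_bigcup.
Qed.

(** A relation that is closed as a subset of Cantor space times Baire space,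
    stated by approximation on finite prefixes. *)
Definition closed_rel (Q : (nat -> bool) -> (nat -> nat) -> Prop) :=
  forall z a, (forall k, exists z' a', [/\ agree k z' z, agree k a' a & Q z' a']) ->
  Q z a.

(** Projections of closed sets along Baire space; the sequence [a] is a
    witness of membership. *)
Definition analytic (A : set (nat -> bool)) :=
  exists2 Q, closed_rel Q & A = [set z | exists a, Q z a].

Lemma analytic_coord n b : analytic [set z | z n = b].
Proof.
exists (fun z _ => z n = b).
  by move=> z a /(_ n.+1)[z' [a' [zz' _ <-]]]; rewrite zz'.
by apply/seteqP; split=> [z h|z []//]; exists (fun=> 0%N).
Qed.

(** The first entry of the witness chooses the member of the union. *)
Lemma analytic_bigcup (F : nat -> set (nat -> bool)) :
  (forall n, analytic (F n)) -> analytic (\bigcup_n F n).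
Proof.
move=> /(_ _)/cid2; move=> /all_sig2[Q clQ FQ].
exists (fun z a => Q (a 0%N) z (fun i => a i.+1)).
  move=> z a h; apply: clQ => k; have [z' [a' [zz' aa' Q']]] := h k.+1.
  exists z', (fun i => a' i.+1); split.
  - exact: agree_le zz'.
  - by move=> i ik; exact: aa'.
  - by rewrite -aa'.
apply/seteqP; split=> [z [n _]|z [a Qa]].
  by rewrite FQ => -[a Qa]; exists (fun i => if i is j.+1 then a j else n).
by exists (a 0%N) => //; rewrite FQ; exists (fun i => a i.+1).
Qed.

(** A modulus of continuity for the reindexing of sequences along [f]. *)
Lemma bounded_codes (f : nat -> nat) k : exists K, (k <= K)%N /\ forall j, (j < k)%N -> (f j < K)%N.
Proof.
elim: k => [|k [K [kK hK]]]; first by exists 0%N.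
exists (maxn K (maxn (f k).+1 k.+1)); split; first by rewrite !leq_max leqnn !orbT.
move=> j; rewrite ltnS leq_eqVlt => /predU1P[->|/hK h].
  by rewrite !leq_max leqnn /= orbT.
by rewrite leq_max h.
Qed.

Definition ncode (n j : nat) : nat := pickle (n, j).
Definition ndecode (k : nat) : nat * nat :=
  if unpickle k is Some p then p else (0%N, 0%N).
Lemma ncodeK n j : ndecode (ncode n j) = (n, j).
Proof. by rewrite /ndecode /ncode pickleK. Qed.

(** The witnesses of all members of the intersection are interleaved into one
    sequence. *)
Lemma analytic_bigcap (F : nat -> set (nat -> bool)) :
  (forall n, analytic (F n)) -> analytic (\bigcap_n F n).
Proof.
move=> /(_ _)/cid2; move=> /all_sig2[Q clQ FQ].
exists (fun z a => forall n, Q n z (fun j => a (ncode n j))).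
  move=> z a h n; apply: clQ => k; have [K [kK hK]] := bounded_codes (ncode n) k.
  have [z' [a' [zz' aa' Q']]] := h K.
  exists z', (fun j => a' (ncode n j)); split.
  - exact: agree_le zz'.
  - by move=> j jk; exact/aa'/hK.
  - exact: Q'.
apply/seteqP; split=> [z h|z [a Qa] n _]; last first.
  by rewrite FQ; exists (fun j => a (ncode n j)).
have {}h n : exists a, Q n z a by have := h n I; rewrite {1}FQ.
have [a Qa] := choice h.
exists (fun k => a (ndecode k).1 (ndecode k).2) => n.
by rewrite (_ : (fun j => _) = a n)//; apply/funext => j; rewrite ncodeK.
Qed.

Lemma analytic_setU A B : analytic A -> analytic B -> analytic (A `|` B).
Proof.
move=> bA bB.
rewrite (_ : A `|` B = \bigcup_n (if n == 0%N then A else B)).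
  by apply: analytic_bigcup => n; case: ifP.
apply/seteqP; split=> [z [Az|Bz]|z [n _]].
- by exists 0%N.
- by exists 1%N.
- by case: ifP => _; [left|right].
Qed.

Lemma analytic_setI A B : analytic A -> analytic B -> analytic (A `&` B).
Proof.
move=> bA bB.
rewrite (_ : A `&` B = \bigcap_n (if n == 0%N then A else B)).
  by apply: analytic_bigcap => n; case: ifP.
apply/seteqP; split=> [z [Az Bz] n _|z h]; first by case: ifP.
by split; [exact: (h 0%N I)|exact: (h 1%N I)].
Qed.

(** Complementation is not available for analytic sets, so both a Borel set
    and its complement are shown analytic at once. *)
Lemma borelC_analytic2 A : borelC A -> analytic A /\ analytic (~` A).
Proof.
elim=> {A} [n|A _ [aA aCA]|F _ ih].
- split; first exact: analytic_coord.
  rewrite (_ : ~` _ = [set z | z n = false]); first exact: analytic_coord.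
  by apply/seteqP; split=> z /=; case: (z n).
- by rewrite setCK.
- split; first by apply: analytic_bigcup => n; case: (ih n).
  by rewrite setC_bigcup; apply: analytic_bigcap => n; case: (ih n).
Qed.

Lemma borelC_analytic A : borelC A -> analytic A.
Proof. by case/borelC_analytic2. Qed.

Definition fstC (z : nat -> bool) : nat -> bool := fun n => z n.*2.
Definition sndC (z : nat -> bool) : nat -> bool := fun n => z n.*2.+1.
(** Interleaving identifies the square of Cantor space with Cantor space. *)
Definition pairC (x y : nat -> bool) : nat -> bool :=
  fun n => if odd n then y n./2 else x n./2.
Lemma fstCK x y : fstC (pairC x y) = x.
Proof. by apply/funext => n; rewrite /fstC /pairC odd_double doubleK. Qed.
Lemma sndCK x y : sndC (pairC x y) = y.
Proof. by apply/funext => n; rewrite /sndC /pairC /= odd_double /= uphalf_double. Qed.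

(** The projected coordinate is absorbed in the witness: an entry codes a bit
    by its parity and a natural number by its half. *)
Lemma analytic_proj A : analytic A -> analytic [set x | exists y, A (pairC x y)].
Proof.
move=> [Q clQ ->].
pose dec (a : nat -> nat) : (nat -> bool) * (nat -> nat) :=
  ((fun n => odd (a n)), (fun n => (a n)./2)).
exists (fun x a => Q (pairC x (dec a).1) (dec a).2).
  move=> x a h; apply: clQ => k; have [x' [a' [xx' aa' Q']]] := h k.
  exists (pairC x' (dec a').1), (dec a').2; split => //.
  - move=> i ik; have ik2 : (i./2 < k)%N.
      apply: leq_ltn_trans ik.
      by rewrite -{2}(odd_double_half i) -addnn addnA leq_addl.
    by rewrite /pairC /=; case: odd; rewrite ?aa' ?xx'.
  - by move=> i ik; rewrite /= aa'.
apply/seteqP; split=> [x [y [a Qa]]|x [a Qa]]; last by do 2 eexists; exact: Qa.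
exists (fun n => (y n + (a n).*2)%N).
rewrite (_ : (dec _).1 = y); last first.
  by apply/funext => n /=; rewrite oddD odd_double addbF oddb.
by rewrite (_ : (dec _).2 = a)//; apply/funext => n /=; rewrite half_bit_double.
Qed.

Lemma analytic_preimage_pr (b : bool) A : analytic A ->
  analytic ((if b then fstC else sndC) @^-1` A).
Proof.
move=> [Q clQ ->].
exists (fun z a => Q ((if b then fstC else sndC) z) a) => // z a h.
apply: clQ => k; have [K [kK hK]] := bounded_codes (fun n => n.*2.+1) k.
have [z' [a' [zz' aa' Q']]] := h K.
exists ((if b then fstC else sndC) z'), a'; split => //; last exact: agree_le aa'.
by move=> i /hK iK; case: (b); rewrite /fstC /sndC zz'// ltnW.
Qed.

(** * Novikov separation *)

Definition separable (A : nat -> set (nat -> bool)) :=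
  exists B : nat -> set (nat -> bool),
    [/\ forall n, borelC (B n), forall n, A n `<=` B n & \bigcap_n B n = set0].

Definition update (T : Type) (k : nat) (v : T) (a : nat -> T) : nat -> T :=
  fun i => if i == k then v else a i.

Section novikov.
Variable Q : nat -> (nat -> bool) -> (nat -> nat) -> Prop.

(** The points of the [n]-th analytic set which agree with [s.1] on the first
    [k] bits and have a witness that agrees with [s.2] on the codes below
    [k].  One counter [k] runs through the bits of the point and through the
    entries of all witnesses, so that each step decides only one bit and one
    entry. *)
Definition stage k (s : (nat -> bool) * (nat -> nat)) (n : nat) :
    set (nat -> bool) :=
  [set w | agree k w s.1 /\
     exists2 b, (forall j, (ncode n j < k)%N -> b j = s.2 (ncode n j)) & Q n w b].

(** If deciding the next bit and entry in all possible ways gave separable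
    families, gluing the separating sets would separate the undecided family:
    take unions over the values of the entry for the set whose witness it
    belongs to, and intersections for the other sets. *)
Lemma stage_step k s : ~ separable (stage k s) ->
  exists p : bool * nat,
    ~ separable (stage k.+1 (update k p.1 s.1, update k p.2 s.2)).
Proof.
apply: contra_notP => /forallNP h.
have {h}/choice[B hB] p : separable (stage k.+1 (update k p.1 s.1, update k p.2 s.2)).
  exact: contrapT (h p).
(* If k codes an entry at all, it is one of the witness of the n0-th set. *)
set n0 := (ndecode k).1.
have stage_sub n b w m : stage k s n w -> b = w k -> n != n0 ->
    stage k.+1 (update k b s.1, update k m s.2) n w.
  move=> [ws [be bes Qb]] -> nn0; split=> /= [i|].
    by rewrite ltnS leq_eqVlt /update => /predU1P[->|ik]; rewrite ?eqxx ?ltn_eqF// ws.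
  exists be => // j; rewrite ltnS leq_eqVlt /update.
  case: eqP => [e|_ /=]; last exact: bes.
  by move: nn0; rewrite /n0 -e ncodeK eqxx.
have stage_n0 b w : stage k s n0 w -> b = w k ->
    exists m, stage k.+1 (update k b s.1, update k m s.2) n0 w.
  move=> [ws [be bes Qb]] ->; exists (be (ndecode k).2); split=> /= [i|].
    by rewrite ltnS leq_eqVlt /update => /predU1P[->|ik]; rewrite ?eqxx ?ltn_eqF// ws.
  exists be => // j; rewrite ltnS leq_eqVlt /update.
  case: eqP => [e _|_ /=]; last exact: bes.
  by rewrite -e ncodeK.
exists (fun n => [set w | exists b, w k = b /\
  if n == n0 then exists m, B (b, m) n w else forall m, B (b, m) n w]); split.
- move=> n; apply: borelC_exists => b; apply: borelC_setI.
    have [] := (borelC_coord k, borelC_setC (borelC_coord k)).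
    case: b; first by move=> + _.
    move=> _; congr borelC; apply/seteqP; split=> w /=; by case: (w k).
  case: (n == n0); [apply: borelC_exists|apply: borelC_forall] => m;
    by case: (hB (b, m)).
- move=> n w swn; exists (w k); split=> //; case: eqP => [e|/eqP nn0].
    rewrite {}e in swn *; have [m hm] := stage_n0 _ _ swn erefl.
    by exists m; case: (hB (w k, m)) => _ + _; apply.
  move=> m; case: (hB (w k, m)) => _ + _; apply; exact: stage_sub.
- apply/seteqP; split=> // w h; have [b [wb]] := h n0 I.
  rewrite eqxx => -[m Bm]; have [_ _ <-] := hB (b, m).
  move=> n _; have [b' [wb']] := h n I; rewrite -wb' wb.
  by case: eqP => [->//|_]; apply.
Qed.

Hypothesis clQ : forall n, closed_rel (Q n).

(** A family that is never separated at any stage determines in the limit a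
    point and a witness for each set.  They cannot all be valid, since the
    sets have no common point; by closedness one of them is refuted at a
    finite stage, where its set is empty and the family is trivially
    separated. *)
Lemma stage_limit : \bigcap_n [set z | exists a, Q n z a] = set0 ->
  separable (fun n => [set z | exists a, Q n z a]).
Proof.
move=> cap0; apply: contrapT => nsep.
pose s0 : (nat -> bool) * (nat -> nat) := (fun=> false, fun=> 0%N).
have {nsep} ns0 : ~ separable (stage 0 s0).
  apply: contra_not nsep; congr separable; apply/funext => n.
  apply/seteqP; split=> [z [_ [a _ Qa]]|z [a Qa]]; first by exists a.
  by split=> //; exists a.
have /choice[step hstep] : forall ks : nat * ((nat -> bool) * (nat -> nat)),
    exists p : bool * nat, ~ separable (stage ks.1 ks.2) ->
    ~ separable (stage ks.1.+1 (update ks.1 p.1 ks.2.1, update ks.1 p.2 ks.2.2)).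
  move=> [k s]; have [ss|ns] := pselect (separable (stage k s)).
    by exists (true, 0%N).
  by have [p hp] := stage_step ns; exists p.
pose next k s := (update k (step (k, s)).1 s.1, update k (step (k, s)).2 s.2).
pose st := fix st k := if k is k'.+1 then next k' (st k') else s0.
have nst k : ~ separable (stage k (st k)).
  by elim: k => [//|k ih]; exact: (hstep (k, st k)).
pose z k := (st k.+1).1 k; pose a k := (st k.+1).2 k.
have stz k i : (i < k)%N -> (st k).1 i = z i /\ (st k).2 i = a i.
  elim: k => // k ih; rewrite ltnS leq_eqVlt => /predU1P[->//|ik].
  have [<- <-] := ih ik.
  by rewrite /= /update /= !ltn_eqF.
have [n nQ] : exists n, ~ Q n z (fun j => a (ncode n j)).
  apply/existsNP => h; suff : set0 z by [].
  by rewrite -cap0 => n _; exists (fun j => a (ncode n j)).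
(* The closed relation n fails on a whole neighbourhood of the limit. *)
have [k hk] : exists k, forall z' a', agree k z' z ->
    agree k a' (fun j => a (ncode n j)) -> ~ Q n z' a'.
  apply: contra_notP nQ => /forallNP h; apply: clQ => k.
  have /existsNP[z' /existsNP[a' h']] := h k.
  by move: h' => /not_implyP[? /not_implyP[? /contrapT ?]]; exists z', a'.
have [K [kK hK]] := bounded_codes (ncode n) k.
apply: (nst K); exists (fun m => if m == n then set0 else setT); split.
- move=> m; case: ifP => _; last exact: borelC_setT.
  by rewrite -setCT; exact/borelC_setC/borelC_setT.
- move=> m w; case: eqP => [->|//] [wz [be hbe]].
  apply: hk => [i ik|j jk]; first by rewrite wz ?(stz _ _ _).1//; exact: leq_trans kK.
  by rewrite hbe ?(stz _ _ _).2//; exact: hK.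
- by apply/seteqP; split=> // w /(_ n I); rewrite eqxx.
Qed.

End novikov.

Lemma novikov (A : nat -> set (nat -> bool)) : (forall n, analytic (A n)) ->
  \bigcap_n A n = set0 -> separable A.
Proof.
move=> /(_ _)/cid2; move=> /all_sig2[Q clQ AQ].
rewrite (_ : A = (fun n => [set z | exists a, Q n z a])); last exact/funext.
exact: stage_limit.
Qed.

(** The case of Novikov separation in which all sets but the first are equal. *)
Lemma lusin_separation (A B : set (nat -> bool)) : analytic A -> analytic B ->
  A `&` B = set0 -> exists2 L, borelC L & A `<=` L /\ L `&` B = set0.
Proof.
move=> aA aB AB0.
have [|//|L [bL AL L0]] := @novikov (fun n => if n == 0%N then A else B).
- by move=> n; case: ifP.
- rewrite -subset0 -AB0 => z h; split; [exact: (h 0%N I)|exact: (h 1%N I)].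
- exists (L 0%N) => //; split; first exact: (AL 0%N).
  rewrite -subset0 -L0 => z [L0z Bz] [//|n] _.
  exact: (AL n.+1).
Qed.

(** * Borel projections of Borel sets with finite sections *)

(** The form in which finiteness of sections and local finiteness are used. *)
Lemma finite_uniform (T : Type) (F : set T) (P : nat -> T -> Prop) :
  finite_set F -> (forall k l t, (k <= l)%N -> P k t -> P l t) ->
  (forall t, F t -> exists k, P k t) -> exists k, forall t, F t -> P k t.
Proof.
elim/Pchoice: T => T in F P * => /finite_seqP[s ->] Pmono.
elim: s => [|t s ih] h; first by exists 0%N.
have [k hk] : exists k, forall t, [set` s] t -> P k t.
  by apply: ih => u us; apply: h; rewrite /= inE us orbT.
have [l hl] := h t (mem_head _ _).
exists (maxn k l) => u; rewrite /= inE => /predU1P[->|us].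
  by apply: Pmono hl; rewrite leq_maxr.
by apply: (Pmono k); [rewrite leq_maxl|exact: hk].
Qed.

(** Compactness of Cantor space, for the open set of sequences with a prefix
    in P. *)
Lemma konig (P : seq bool -> Prop) : (forall y, exists k, P (mkseq y k)) ->
  exists n, forall y, exists2 k, (k <= n)%N & P (mkseq y k).
Proof.
(* A word is bad if no bounded level covers its extensions; a bad word has a
   bad one-bit extension. *)
move=> hP; pose bad s := forall n, exists2 y, mkseq y (size s) = s &
  forall k, (k <= n)%N -> ~ P (mkseq y k).
apply: contrapT => nP.
have bad0 : bad [::].
  move=> n; have /forallNP/(_ n)/existsNP[y hy] := nP; exists y => // k kn Pk.
  by apply: hy; exists k.
have /choice[b hb] : forall s, exists b : bool, bad s -> bad (rcons s b).
  move=> s; have [bads|] := pselect (bad s); last by exists true.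
  apply: contrapT => /forallNP h.
  have /(_ _)/not_implyP/=h' b := h b.
  have {h h'}/choice[n hn] b : exists n, forall y,
      mkseq y (size s).+1 = rcons s b -> exists2 k, (k <= n)%N & P (mkseq y k).
    have [_ /existsNP[n hn]] := h' b; exists n => y ys; apply: contrapT => h2.
    apply: hn; exists y; first by rewrite size_rcons.
    by move=> k kn Pk; apply: h2; exists k.
  have [y ys yP] := bads (maxn (n true) (n false)).
  have [|k kn Pk] := hn (y (size s)) y; first by rewrite mkseqS ys.
  apply: (yP k) => //; rewrite leq_max.
  by case: (y (size s)) kn => ->; rewrite ?orbT.
pose S := fix S k := if k is k'.+1 then rcons (S k') (b (S k')) else [::].
have badS k : bad (S k) by elim: k => // k; exact: hb.
pose z k := b (S k).
have zS k : mkseq z k = S k by elim: k => // k ih; rewrite mkseqS ih.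
have [k Pk] := hP z; have [y ys] := badS k k.
move=> /(_ k (leqnn k)); apply.
by rewrite -zS size_mkseq in ys; rewrite ys.
Qed.

Definition cyl (s : seq bool) : set (nat -> bool) :=
  [set y | mkseq y (size s) = s].

Lemma borelC_eq n b : borelC [set z | z n = b].
Proof.
case: b; first exact: borelC_coord.
rewrite (_ : mkset _ = ~` [set z : nat -> bool | z n]).
  exact/borelC_setC/borelC_coord.
by apply/seteqP; split=> z /=; case: (z n).
Qed.

Lemma borelC_cyl s : borelC (cyl s).
Proof.
rewrite (_ : cyl s = [set y | forall i, (i < size s)%N -> y i = nth false s i]).
  apply: borelC_forall => i; apply: borelC_imply; first exact: borelC_const.
  exact: borelC_eq.
apply/seteqP; split=> [y ys i si|y ys]; first by rewrite -ys nth_mkseq.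
apply: (@eq_from_nth _ false); rewrite size_mkseq// => i si.
by rewrite nth_mkseq// ys.
Qed.

Lemma pairC_eta z : pairC (fstC z) (sndC z) = z.
Proof.
apply/funext => n; rewrite /pairC /fstC /sndC.
by case: (odd n) (odd_double_half n) => e; rewrite -[in RHS]e.
Qed.

Lemma mkseq_agree k (y y' : nat -> bool) : mkseq y k = mkseq y' k -> agree k y y'.
Proof.
move=> e i ik; have := congr1 (fun s => nth false s i) e.
by rewrite !nth_mkseq.
Qed.

Lemma take_mkseq (y : nat -> bool) k n : (k <= n)%N -> take k (mkseq y n) = mkseq y k.
Proof. by move=> kn; rewrite /mkseq -map_take take_iota (minn_idPl kn). Qed.

(** For each cylinder, the points whose section meets it form an analytic set
    [M s].  Sections being closed, a point outside H has a cylinder around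
    its second coordinate that avoids the section, so the complement of H is
    covered by the products of the complements of [M s] with the cylinders.
    Novikov separation makes this cover Borel and Lusin separation replaces
    the complement of [M s] by a Borel subset [L s].  By compactness, the
    section over x is empty exactly when the cylinders s with x in [L s]
    cover Cantor space at a finite level, which is a Borel condition. *)
Lemma borelC_proj H : borelC H ->
  (forall x, finite_set [set y | H (pairC x y)]) ->
  borelC [set x | exists y, H (pairC x y)].
Proof.
move=> bH finH.
have bfst B : borelC B -> borelC (fstC @^-1` B).
  by apply: borelC_preimage => n; exact: borelC_coord.
have bsnd B : borelC B -> borelC (sndC @^-1` B).
  by apply: borelC_preimage => n; exact: borelC_coord.
pose M s : set (nat -> bool) := [set x | exists y, (H `&` sndC @^-1` cyl s) (pairC x y)].
have aM s : analytic (M s).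
  by apply/analytic_proj/borelC_analytic/borelC_setI => //; exact/bsnd/borelC_cyl.
(* The points outside H that the product over the cylinder s does not cover. *)
pose A s := ~` H `&` (fstC @^-1` M s `|` sndC @^-1` (~` cyl s)).
have aA s : analytic (A s).
  apply: analytic_setI; first exact/borelC_analytic/borelC_setC.
  apply: analytic_setU; first exact: (@analytic_preimage_pr true).
  exact/borelC_analytic/bsnd/borelC_setC/borelC_cyl.
have [||B [bB AB capB]] :=
    @novikov (fun n => if pickle_inv n is Some s then A s else setT).
- by move=> n; case: pickle_inv => //; exact/borelC_analytic/borelC_setT.
- rewrite -subset0 => z h.
  have zA s : A s z by have := h (pickle s) I; rewrite pickleK_inv.
  have nH : ~ H z by case: (zA [::]).
  have [k hk] : exists k, forall y, H (pairC (fstC z) y) -> ~ agree k y (sndC z).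
    apply: (@finite_uniform _ [set y | H (pairC (fstC z) y)]
      (fun k y => ~ agree k y (sndC z))) => //.
      by move=> k l t kl; apply: contra_not => /(agree_le kl).
    move=> y /= Hy; apply/existsNP => e; apply: nH.
    rewrite -[z]pairC_eta (_ : sndC z = y)//; apply/funext => i.
    by rewrite (e i.+1).
  have [_ [[y [Hy]]|]] := zA (mkseq (sndC z) k).
    rewrite /preimage /= sndCK /cyl /= size_mkseq => /mkseq_agree.
    exact: hk.
  by rewrite /preimage /cyl /= size_mkseq.
have /choice[L hL] s : exists L, [/\ borelC L,
    forall z, ~ H z -> ~ B (pickle s) z -> L (fstC z) & L `&` M s = set0].
  have [|//||L bL [subL L0]] := @lusin_separation
      [set x | exists y, (~` H `&` ~` B (pickle s)) (pairC x y)] (M s).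
  - by apply/analytic_proj/borelC_analytic/borelC_setI; exact: borelC_setC.
  - rewrite -subset0 => x [[y [nH nB]] Mx]; apply: nB.
    by apply: AB; rewrite pickleK_inv; split=> //; left; rewrite /preimage /= fstCK.
  - exists L; split=> // z nH nB; apply: subL; exists (sndC z).
    by rewrite pairC_eta.
rewrite (_ : [set _ | _] = ~` [set x | exists n, forall s : n.-tuple bool,
    exists k : nat, L (take k s) x]); last first.
  apply/seteqP; split=> x.
    move=> [y Hy] [n /(_ [tuple of mkseq y n])[k /= Lx]].
    (* Prefixes of length above n are the word itself. *)
    wlog kn : k Lx / (k <= n)%N.
      move=> hw; have [|nk] := leqP k n; first exact: hw.
      apply: (hw n) => //; move: Lx; rewrite !take_oversize ?size_mkseq//.
      exact: ltnW.
    rewrite take_mkseq// in Lx; have [_ _] := hL (mkseq y k).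
    rewrite -subset0 => /(_ x); apply; split=> //; exists y; split=> //.
    by rewrite /preimage /cyl /= sndCK size_mkseq.
  apply: contra_notP => nH.
  have [|n hn] := @konig (fun s => L s x).
    move=> y; have nHy : ~ H (pairC x y) by move=> ?; apply: nH; exists y.
    have [s [nB ys]] : exists s, ~ B (pickle s) (pairC x y) /\ cyl s y.
      apply: contrapT => /forallNP h; suff : set0 (pairC x y) by [].
      rewrite -capB => n _; apply: contrapT => nB.
      case E: (@pickle_inv (seq bool) n) => [s|]; last by apply: nB; apply: AB; rewrite E.
      have e : pickle s = n.
        by move: (@pickle_invK (seq bool) n); rewrite E.
      apply: (h s); rewrite e; split=> //; apply: contrapT => ncyl.
      by apply: nB; apply: AB; rewrite E; split => //; right; rewrite /preimage /= sndCK.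
    have [_ /(_ _ nHy nB) + _] := hL s; rewrite fstCK.
    by exists (size s); rewrite ys.
  exists n => s; have [k kn Lk] := hn (nth false s).
  by exists k; move: Lk; rewrite -(take_mkseq _ kn) -{2}(size_tuple s) mkseq_nth.
apply: borelC_setC; apply: borelC_exists => n; apply: borelC_forall => s.
by apply: borelC_exists => k; case: (hL (take k s)).
Qed.

(** * Coding a Polish space by binary sequences *)

Section polish_code.
Local Open Scope ring_scope.
Context {R : realType} {S : metricType R}.
Variables (d : nat -> S).

Let r k : R := k.+1%:R^-1.

Definition ball_code (x : S) (n : nat) : bool :=
  mdist (d (ndecode n).1) x < r (ndecode n).2.

Hypothesis d_dense : forall x (e : R), 0 < e -> exists i, mdist (d i) x < e.
Hypothesis S_complete : forall F : set_system S,
  ProperFilter F -> cauchy F -> exists x : S, F --> x.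

Let r_gt0 k : 0 < r k. Proof. by rewrite invr_gt0. Qed.

Let r_small (e : R) : 0 < e -> \forall k \near \oo, r k < e.
Proof. by move=> e0; exact: (near_infty_natSinv_lt (PosNum e0)). Qed.

Lemma ball_codeE x i k : ball_code x (ncode i k) = (mdist (d i) x < r k).
Proof. by rewrite /ball_code ncodeK. Qed.

Lemma ball_code_separates x y : ball_code x = ball_code y -> x = y.
Proof.
move=> e; apply: mdist_positivity; apply/eqP; rewrite eq_le mdist_ge0 andbT.
apply/ler_addgt0Pl => eps eps0; rewrite addr0.
have e20 : 0 < eps / 2 by rewrite divr_gt0.
have [k _ /(_ _ (leqnn k)) rk] := r_small e20.
have [i di] := d_dense x (r_gt0 k).
have : ball_code x (ncode i k) by rewrite ball_codeE.
rewrite e ball_codeE => dy.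
rewrite (le_trans (metric_triangle x (d i) y))// (splitr eps) metric_sym lerD//.
  exact/ltW/(lt_trans di).
exact/ltW/(lt_trans dy).
Qed.

(** The conditions on a binary sequence that make it the code of a point: the
    listed balls include arbitrarily small ones (1), they are pairwise
    compatible, which yields a Cauchy sequence of centres (2), a ball is
    listed exactly when it contains a listed ball with room to spare, which
    excludes points on the boundary (3 and 4); indices which code no pair
    repeat the index that they decode to. *)
Definition code_axioms (z : nat -> bool) :=
  [/\ forall k, exists i, z (ncode i k),
      forall i k j l, z (ncode i k) -> z (ncode j l) ->
        mdist (d i) (d j) < r k + r l,
      forall j l, z (ncode j l) ->
        exists m k, z (ncode m k) /\ mdist (d m) (d j) + r k < r l &
      (forall j l m k, mdist (d m) (d j) + r k < r l -> z (ncode m k) ->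
        z (ncode j l)) /\
      (forall n, n != ncode (ndecode n).1 (ndecode n).2 ->
        z n = z (ncode (ndecode n).1 (ndecode n).2))].

(** By completeness the centres of smaller and smaller listed balls converge,
    and the axioms say that the limit has the given code. *)
Lemma range_ball_code : range ball_code = [set z | code_axioms z].
Proof.
apply/seteqP; split=> [_ [x _ <-]|z [zex zcomp zin [zout zjunk]]].
  split.
  - by move=> k; have [i di] := d_dense x (r_gt0 k); exists i; rewrite ball_codeE.
  - move=> i k j l; rewrite !ball_codeE => ik jl.
    by rewrite (le_lt_trans (metric_triangle _ x _))// [mdist x _]metric_sym ltrD.
  - move=> j l; rewrite ball_codeE => jl.
    have e20 : 0 < (r l - mdist (d j) x) / 2 by rewrite divr_gt0// subr_gt0.
    have [k _ /(_ _ (leqnn k)) rk] := r_small e20.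
    have [m mx] := d_dense x (r_gt0 k).
    exists m, k; rewrite ball_codeE; split=> //.
    have := metric_triangle (d m) x (d j); rewrite [mdist x _]metric_sym.
    move: rk mx; lra.
  - split=> [j l m k dml|n _]; last by rewrite /ball_code ncodeK.
    rewrite !ball_codeE => mk; have := metric_triangle (d j) (d m) x.
    rewrite [mdist (d j) (d m)]metric_sym.
    move: dml mk; lra.
have /choice[i zi] := zex.
have [x Fx] : exists x : S, d (i k) @[k --> \oo] --> x.
  apply: S_complete; apply: cauchy_exP => e e0.
  have e20 : 0 < e / 2 by rewrite divr_gt0.
  have [k _ rk] := r_small e20.
  exists (d (i k)); exists k => //= m km; rewrite ballEmdist /=.
  have := zcomp _ _ _ _ (zi k) (zi m).
  have := rk _ (leqnn k); have := rk _ km; rewrite /=; lra.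
have Fx' (e : R) : 0 < e -> \forall k \near \oo, mdist x (d (i k)) < e.
  move=> e0; have /= := Fx _ (nbhsx_ballx x _ e0).
  by rewrite ballEmdist.
have zle j l : z (ncode j l) -> mdist (d j) x <= r l.
  move=> zjl; rewrite leNgt; apply/negP => lt.
  have e20 : 0 < (mdist (d j) x - r l) / 2 by rewrite divr_gt0// subr_gt0.
  have [k [xk rk]] : exists k, mdist x (d (i k)) < (mdist (d j) x - r l) / 2 /\
      r k < (mdist (d j) x - r l) / 2.
    have [k _ hk] : \forall k \near \oo,
        mdist x (d (i k)) < (mdist (d j) x - r l) / 2 /\
        r k < (mdist (d j) x - r l) / 2.
      by apply: filterI; [exact: Fx'|exact: r_small].
    by exists k; exact: hk (leqnn k).
  have := zcomp _ _ _ _ zjl (zi k).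
  have := metric_triangle (d j) (d (i k)) x; rewrite [mdist _ x]metric_sym in xk *.
  move: xk rk; rewrite ![mdist x _]metric_sym; lra.
exists x => //; apply/funext => n.
suff zcode j l : z (ncode j l) = (mdist (d j) x < r l).
  rewrite /ball_code -zcode.
  have [e|/zjunk ->//] := eqVneq n (ncode (ndecode n).1 (ndecode n).2).
  by rewrite -e.
apply/idP/idP => [/zin[m [k [/zle zmk h]]]|lt].
  have := metric_triangle (d j) (d m) x; rewrite [mdist (d j) (d m)]metric_sym.
  move: zmk h; lra.
have e20 : 0 < (r l - mdist (d j) x) / 2 by rewrite divr_gt0// subr_gt0.
have [k _ hk] : \forall k \near \oo,
    mdist x (d (i k)) < (r l - mdist (d j) x) / 2 /\
    r k < (r l - mdist (d j) x) / 2.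
  by apply: filterI; [exact: Fx'|exact: r_small].
have [xk rk] := hk _ (leqnn k).
apply: (zout _ _ _ _ _ (zi k)).
have := metric_triangle (d (i k)) x (d j).
move: xk rk; rewrite ![mdist x _]metric_sym; lra.
Qed.

Lemma borelC_range_ball_code : borelC (range ball_code).
Proof.
rewrite range_ball_code.
have bz := borelC_coord.
have -> : [set z : nat -> bool | code_axioms z] =
  [set z : nat -> bool | forall k, exists i, z (ncode i k)] `&`
  [set z : nat -> bool | forall p : nat * nat * (nat * nat), z (ncode p.1.1 p.1.2) ->
     z (ncode p.2.1 p.2.2) ->
     mdist (d p.1.1) (d p.2.1) < r p.1.2 + r p.2.2] `&`
  [set z : nat -> bool | forall p : nat * nat, z (ncode p.1 p.2) -> exists q : nat * nat,
     z (ncode q.1 q.2) /\ mdist (d q.1) (d p.1) + r q.2 < r p.2] `&`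
  [set z : nat -> bool | forall p : nat * nat * (nat * nat),
     mdist (d p.2.1) (d p.1.1) + r p.2.2 < r p.1.2 ->
     z (ncode p.2.1 p.2.2) -> z (ncode p.1.1 p.1.2)] `&`
  [set z : nat -> bool | forall n, n != ncode (ndecode n).1 (ndecode n).2 ->
        forall b : bool, z n = b -> z (ncode (ndecode n).1 (ndecode n).2) = b].
  apply/seteqP; split=> z.
    move=> [h1 h2 h3 [h4 h5]]; split; last by move=> n /h5 ->.
    split; last by move=> [[? ?] [? ?]] /=; exact: h4.
    split; last first.
      by move=> [j l] /= /h3[m [k h]]; exists (m, k).
    by split => // -[[? ?] [? ?]] /=; exact: h2.
  move=> [[[[h1 h2] h3] h4] h5]; split => //.
  - by move=> i k j l; exact: (h2 ((i, k), (j, l))).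
  - by move=> j l /(h3 (j, l))[[m k] ?]; exists m, k.
  - split; first by move=> j l m k; exact: (h4 ((j, l), (m, k))).
    by move=> n /h5/(_ _ erefl).
do ![apply: borelC_setI].
- by apply: borelC_forall => k; apply: borelC_exists => i; exact: bz.
- apply: borelC_forall => p; apply: borelC_imply; first exact: bz.
  by apply: borelC_imply; [exact: bz|exact: borelC_const].
- apply: borelC_forall => p; apply: borelC_imply; first exact: bz.
  apply: borelC_exists => q; apply: borelC_setI; first exact: bz.
  exact: borelC_const.
- apply: borelC_forall => p; apply: borelC_imply; first exact: borelC_const.
  by apply: borelC_imply; exact: bz.
- apply: borelC_forall => n; apply: borelC_imply; first exact: borelC_const.
  apply: borelC_forall => b; apply: borelC_imply; exact: borelC_eq.
Qed.

Lemma open_ball_code (O : set S) : open O ->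
  O = \bigcup_(n in [set n | [set x | ball_code x n] `<=` O]) [set x | ball_code x n].
Proof.
move=> oO; apply/seteqP; split=> [x Ox|x [n nO xn]]; last exact: nO.
have /nbhs_ballP[e /= e0 xeO] : nbhs x O by exact: open_nbhs_nbhs.
have e20 : 0 < e / 2 by rewrite divr_gt0.
have [k _ /(_ _ (leqnn k)) rk] := r_small e20.
have [i ix] := d_dense x (r_gt0 k).
exists (ncode i k); last by rewrite /= ball_codeE.
move=> y /=; rewrite ball_codeE => iy; apply: xeO; rewrite ballEmdist /=.
have := metric_triangle x (d i) y; rewrite [mdist x (d i)]metric_sym.
move: rk ix iy; rewrite /=; lra.
Qed.

Lemma open_ball_codeW n : open [set x | ball_code x n].
Proof.
rewrite openE => x /= xn; apply/nbhs_ballP.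
exists (r (ndecode n).2 - mdist (d (ndecode n).1) x) => [|y] /=.
  by rewrite subr_gt0.
rewrite ballEmdist /ball_code /= => xy.
by rewrite (le_lt_trans (metric_triangle _ x _))// -ltrBrDl.
Qed.

End polish_code.

(** * Coding a standard Borel space *)

Section coding.
Context {d : measure_display} {X : measurableType d}.

(** A coding presents X as a Borel subset of Cantor space whose measurable
    sets are generated by the coordinates; this is all that is used of the
    Polish structure. *)
Definition coding (e : X -> nat -> bool) :=
  [/\ injective e, forall n, measurable [set x | e x n],
      forall A, measurable A -> <<s [set [set x | e x n] | n in setT] >> A &
      borelC (range e)].

Lemma standard_borel_coding (R : realType) : standard_borel R X ->
  exists e, coding e.
Proof.
move=> [S [f [[complS [D cD dD]] bijf mf]]].
have injf : injective f by exact: bij_inj.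
have surf s : exists x, f x = s by case: bijf => g _ gK; exists (g s).
have /countable_injP[g ginj] := cD.
have [t tE] : exists t : nat -> S, forall s, D s -> exists n, t n = s.
  have /choice[t ht] : forall n, exists s, (exists2 s', D s' & g s' = n) ->
      D s /\ g s = n.
    move=> n; have [[s Ds gs]|h] := pselect (exists2 s', D s' & g s' = n).
      by exists s.
    by exists (f point).
  exists t => s Ds; exists (g s); have [|Dt gt] := ht (g s); first by exists s.
  by apply: ginj; rewrite ?inE.
have dense_t x (e : R) : (0 < e)%R -> exists i, (mdist (t i) x < e)%R.
  move=> e0; have [||s []] := dD [set y | mdist x y < e]%R.
  - by exists x; rewrite /= mdistxx.
  - rewrite openE => y /= xy; apply/nbhs_ballP; exists (e - mdist x y)%R => [|z] /=.
      by rewrite subr_gt0.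
    rewrite ballEmdist /= => yz.
    by rewrite (le_lt_trans (metric_triangle _ y _))// -ltrBrDl.
  - by move=> /= xs /tE[n tn]; exists n; rewrite tn metric_sym.
exists (fun x => ball_code t (f x)); split.
- by move=> x y /(ball_code_separates dense_t)/injf.
- move=> n; apply/mf; apply: sub_sigma_algebra.
  rewrite (_ : f @` _ = [set s | ball_code t s n]); first exact: open_ball_codeW.
  apply/seteqP; split=> [_ [x xn <-]//|s sn].
  by have [x xs] := surf s; exists x; rewrite //= xs.
- move=> A /mf Af; pose Gen := [set [set x | ball_code t (f x) n] | n in setT].
  suff gen B : <<s @open S >> B -> <<s Gen >> (f @^-1` B).
    rewrite (_ : A = f @^-1` (f @` A)); first exact: gen.
    apply/seteqP; split=> [x Ax|x [y Ay /injf <-]//]; by exists x.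
  apply: (@smallest_sub _ _ _ [set B | <<s Gen >> (f @^-1` B)]) => /=.
    split=> /= [|C|F hF].
    - rewrite preimage_set0; exact: sigma_algebra0.
    - by move=> hC; rewrite setTD preimage_setC -setTD; exact: sigma_algebraCD.
    - by rewrite preimage_bigcup; exact: sigma_algebra_bigcup.
  move=> O oO /=; rewrite (open_ball_code dense_t oO) bigcup_mkcond.
  rewrite preimage_bigcup; apply: sigma_algebra_bigcup => n.
  case: ifP => _; last by rewrite preimage_set0; exact: sigma_algebra0.
  by apply: sub_sigma_algebra; exists n.
- rewrite (_ : _ @` setT = range (ball_code t)).
    exact: borelC_range_ball_code.
  apply/seteqP; split=> [_ [x _ <-]|_ [s _ <-]]; first by exists (f x).
  by have [x <-] := surf s; exists x.
Qed.

Variable e : X -> nat -> bool.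
Hypothesis ecoding : coding e.

Lemma coding_inj : injective e. Proof. by case: ecoding. Qed.

Lemma measurable_coord n : measurable [set x | e x n].
Proof. by case: ecoding. Qed.

Lemma measurable_code_preimage B : borelC B -> measurable (e @^-1` B).
Proof.
elim=> [n|A _ ih|F _ ih]; first exact: measurable_coord.
- by rewrite preimage_setC; exact: measurableC.
- by rewrite preimage_bigcup; exact: bigcupT_measurable.
Qed.

Lemma borelC_image A : measurable A -> borelC (e @` A).
Proof.
case: ecoding => inj _ gen rng /gen; move: A.
apply: (@smallest_sub _ _ _ [set B | borelC (e @` B)]) => /=.
  split=> /= [|C|F hF].
  - by rewrite image_set0 -setCT; exact/borelC_setC/borelC_setT.
  - move=> hC; rewrite (_ : _ @` _ = range e `&` ~` (e @` C)).
      by apply: borelC_setI => //; exact: borelC_setC.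
    apply/seteqP; split=> [_ [x [_ nC] <-]|_ [[x _ <-] nC]].
      by split; [exists x|move=> [y Cy /inj yx]; apply: nC; rewrite -yx].
    by exists x => //; split=> // Cx; apply: nC; exists x.
  - by rewrite image_bigcup; exact: borelC_bigcup.
move=> _ [n _ <-] /=; rewrite (_ : _ @` _ = range e `&` [set z | z n]).
  by apply: borelC_setI => //; exact: borelC_coord.
apply/seteqP; split=> [_ [x xn <-]|_ [[x _ <-] xn]]; last by exists x.
by split=> //; exists x.
Qed.

Lemma borelC_image2 (M : set (X * X)) : measurable M ->
  borelC [set z | exists2 p, M p & z = pairC (e p.1) (e p.2)].
Proof.
move: M; pose im (M : set (X * X)) : set (nat -> bool) :=
  [set z | exists2 p, M p & z = pairC (e p.1) (e p.2)].
move=> M; rewrite -/(im M); move: M.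
have [inj _ _ rng] := ecoding.
have bfst B : borelC B -> borelC (fstC @^-1` B).
  by apply: borelC_preimage => n; exact: borelC_coord.
have bsnd B : borelC B -> borelC (sndC @^-1` B).
  by apply: borelC_preimage => n; exact: borelC_coord.
have imX A B : measurable A -> measurable B -> borelC (im (A `*` B)).
  move=> mA mB; rewrite (_ : im _ = fstC @^-1` (e @` A) `&` sndC @^-1` (e @` B)).
    by apply: borelC_setI; [apply: bfst|apply: bsnd]; exact: borelC_image.
  apply/seteqP; split=> [_ [[x y] [/= Ax By] ->]|z [[x Ax zx] [y By zy]]].
    by split; rewrite /preimage /= ?fstCK ?sndCK; [exists x|exists y].
  by exists (x, y) => //=; rewrite zx zy pairC_eta.
apply: (@smallest_sub _ _ _ [set B | borelC (im B)]) => /=.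
  split=> /= [|C|F hF].
  - by have := imX _ _ measurableT measurable0; rewrite setX0.
  - move=> hC; rewrite (_ : im _ = im setT `&` ~` (im C)).
      apply: borelC_setI; last exact: borelC_setC.
      by rewrite -setXTT; exact: imX.
    apply/seteqP; split=> [_ [[x y] [_ nC] ->]|_ [[[x y] _ ->] nC]].
      split; first by exists (x, y).
      move=> [[x' y'] C' /= eq]; apply: nC.
      have := congr1 fstC eq; rewrite !fstCK => /inj ->.
      by have := congr1 sndC eq; rewrite !sndCK => /inj ->.
    by exists (x, y) => //; split=> // Cx; apply: nC; exists (x, y).
  - rewrite (_ : im _ = \bigcup_n im (F n)); first exact: borelC_bigcup.
    apply/seteqP; split=> [z [p [n _ Fp] ->]|z [n _ [p Fp ->]]].
      by exists n => //; exists p.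
    by exists p => //; exists n.
move=> M [] [A mA <-] /=; rewrite setTI.
- by rewrite -setXT; exact: imX.
- by rewrite -setTX; exact: imX.
Qed.

(** Transport of the projection theorem on Cantor space along a coding. *)
Lemma measurable_proj (M : set (X * X)) : measurable M ->
  (forall x, finite_set [set y | M (x, y)]) ->
  measurable [set x | exists y, M (x, y)].
Proof.
move=> mM finM; have [inj _ _ rng] := ecoding.
have h := borelC_proj (borelC_image2 mM).
pose P := e @^-1` [set x | exists y, [set z | exists2 p, M p &
  z = pairC (e p.1) (e p.2)] (pairC x y)].
rewrite (_ : [set _ | _] = P); last first.
  apply/seteqP; split=> [x [y Mxy]|x [z [[x' y] Mxy /= eq]]].
    by exists (e y), (x, y).
  exists y; have := congr1 fstC eq; rewrite !fstCK => /inj ->.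
  exact: Mxy.
apply/measurable_code_preimage/h => z; apply: (@sub_finite_set _ _
  (e @` [set y | exists2 x, e x = z & M (x, y)])).
  move=> w [[x y] Mxy /= eq]; exists y.
    by exists x => //; have := congr1 fstC eq; rewrite !fstCK.
  by have := congr1 sndC eq; rewrite !sndCK.
apply: finite_image; have [[x xz]|nx] := pselect (exists x, e x = z).
  apply: sub_finite_set (finM x) => y [x' x'z].
  by move: xz; rewrite -x'z => /inj ->.
apply: (sub_finite_set (B := set0)) => // y [x xz _].
by apply: nx; exists x.
Qed.

Lemma measurable_eq_fun d' (T : measurableType d') (h1 h2 : T -> X) :
  measurable_fun setT h1 -> measurable_fun setT h2 ->
  measurable [set x | h1 x = h2 x].
Proof.
move=> m1 m2.
rewrite (_ : [set _ | _] = \bigcap_n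
   ((h1 @^-1` [set x | e x n] `&` h2 @^-1` [set x | e x n]) `|`
    (~` (h1 @^-1` [set x | e x n]) `&` ~` (h2 @^-1` [set x | e x n])))).
  apply: bigcapT_measurable => n.
  have mh (h : T -> X) : measurable_fun setT h -> measurable (h @^-1` [set x | e x n]).
    by move=> mh; have := mh measurableT _ (measurable_coord n); rewrite setTI.
  by apply: measurableU; apply: measurableI; rewrite ?setCI; do ?apply: measurableC; exact: mh.
apply/seteqP; split=> [x /= h12 n _|x h].
  by have [h|h] := pselect (e (h2 x) n); [left|right]; rewrite /preimage /= h12.
apply: coding_inj; apply/funext => n.
have [[/= -> ->//]|[/= /negP/negbTE -> /negP/negbTE ->//]] := h n I.
Qed.

Lemma measurable_fun_code d' (T : measurableType d') (h : T -> X) :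
  (forall n, measurable (h @^-1` [set x | e x n])) -> measurable_fun setT h.
Proof.
case: ecoding => _ _ gen _ mh _ A /gen; rewrite setTI; move: A.
apply: (@smallest_sub _ _ _ [set B | measurable (h @^-1` B)]) => /=.
  split=> /= [|C|F hF].
  - by rewrite preimage_set0.
  - by move=> mC; rewrite setTD preimage_setC; exact: measurableC.
  - by rewrite preimage_bigcup; exact: bigcupT_measurable.
by move=> _ [n _ <-] /=.
Qed.

End coding.

(** * Borel functions enumerating the neighbours *)

Lemma measurable_fun_piecewise d d' (T : measurableType d) (T' : measurableType d')
    (D : set T) (h1 h2 : T -> T') : measurable D ->
  measurable_fun setT h1 -> measurable_fun setT h2 ->
  measurable_fun setT (fun x => if `[< D x >] then h1 x else h2 x).
Proof.
move=> mD m1 m2 _ B mB; rewrite setTI.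
rewrite (_ : _ @^-1` B = (D `&` h1 @^-1` B) `|` (~` D `&` h2 @^-1` B)).
  have {}m1 := m1 measurableT B mB; have {}m2 := m2 measurableT B mB.
  rewrite !setTI in m1 m2; apply: measurableU; apply: measurableI => //.
  exact: measurableC.
rewrite predeqE => x; rewrite /preimage /=; case: asboolP => Dx; split.
- by left.
- by case=> -[].
- by right.
- by case=> -[].
Qed.

Lemma measurable_preimage d d' (T : measurableType d) (T' : measurableType d')
    (h : T -> T') (B : set T') : measurable_fun setT h -> measurable B ->
  measurable [set x | B (h x)].
Proof. by move=> mh mB; have := mh measurableT B mB; rewrite setTI. Qed.

Lemma measurable_exists d (T : measurableType d) (I : countType) (F : I -> set T) :
  (forall i, measurable (F i)) -> measurable [set x | exists i, F i x].
Proof.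
move=> mF; rewrite (_ : [set _ | _] =
  \bigcup_n (if @pickle_inv I n is Some i then F i else set0)).
  by apply: bigcupT_measurable => n; case: pickle_inv.
apply/seteqP; split=> [x [i Fi]|x [n _]].
  by exists (pickle i) => //; rewrite pickleK_inv.
by case: pickle_inv => // i; exists i.
Qed.

Lemma measurable_forall d (T : measurableType d) (I : countType) (F : I -> set T) :
  (forall i, measurable (F i)) -> measurable [set x | forall i, F i x].
Proof.
move=> mF; rewrite (_ : [set _ | _] = ~` [set x | exists i, (~` F i) x]).
  by apply/measurableC/measurable_exists => i; exact: measurableC.
apply/seteqP; split=> [x h [i]|x /forallNP h i]; first by apply; exact: h.
exact: contrapT (h i).
Qed.

Lemma measurable_prop d (T : measurableType d) (P : Prop) :
  measurable [set _ : T | P].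
Proof.
have [p|np] := pselect P.
  by rewrite (_ : mkset _ = setT); [exact: measurableT|apply/seteqP; split].
by rewrite (_ : mkset _ = set0); [exact: measurable0|apply/seteqP; split].
Qed.

Lemma measurable_imply d (T : measurableType d) (A B : set T) :
  measurable A -> measurable B -> measurable [set x | A x -> B x].
Proof.
move=> mA mB; rewrite (_ : mkset _ = ~` A `|` B).
  by apply: measurableU => //; exact: measurableC.
apply/seteqP; split=> [x h|x /= [nA Ax|Bx _]] //.
by have [/h|] := pselect (A x); [right|left].
Qed.

Lemma first_index (P : nat -> Prop) : (exists n, P n) ->
  exists2 n, P n & forall k, (k < n)%N -> ~ P k.
Proof.
move=> [n Pn]; have ex : exists n, `[< P n >] by exists n; exact/asboolP.
exists (ex_minn ex); case: ex_minnP => m /asboolP Pm mmin //.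
by move=> k km /asboolP/mmin; rewrite leqNgt km.
Qed.

(** Borel choice among countably many candidates: the first admissible one is
    taken. *)
Lemma measurable_first_select d (X : measurableType d) (P : nat -> set X)
    (h : nat -> X -> X) : (forall n, measurable (P n)) ->
  (forall n, measurable_fun setT (h n)) ->
  exists2 s : X -> X, measurable_fun setT s &
    forall x, (forall n, P n x -> (forall k, (k < n)%N -> ~ P k x) -> s x = h n x) /\
              ((forall n, ~ P n x) -> s x = x).
Proof.
move=> mP mh.
pose D n := [set x | P n x /\ forall k, (k < n)%N -> ~ P k x].
have mD n : measurable (D n).
  apply: measurableI => //; apply: measurable_forall => k.
  by apply: measurable_imply; [exact: measurable_prop|exact: measurableC].
have h' x : exists y, (forall n, D n x -> y = h n x) /\ ((forall n, ~ P n x) -> y = x).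
  have [/first_index[n Pn nmin]|/forallNP nP] := pselect (exists n, P n x); last first.
    by exists x; split=> // n [/nP].
  exists (h n x); split; last by move=> /(_ n)/(_ Pn).
  move=> m [Pm mmin]; rewrite (_ : m = n)//; by case: (ltngtP m n) => // [/nmin|/mmin].
have [s hs] := choice h'; exists s; last first.
  by move=> x; split; [move=> n Pn nmin; apply: (hs x).1; split|exact: (hs x).2].
move=> _ B mB; rewrite setTI.
rewrite (_ : s @^-1` B = [set x | exists n, D n x /\ B (h n x)] `|`
   ([set x | forall n, (~` P n) x] `&` B)).
  apply: measurableU.
    apply: measurable_exists => n; apply: measurableI => //.
    exact: measurable_preimage.
  by apply: measurableI => //; apply: measurable_forall => n; exact: measurableC.
apply/seteqP; split=> x; rewrite /preimage /=.
  move=> Bs; have [/first_index[n Pn nmin]|/forallNP nP] := pselect (exists n, P n x).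
    by left; exists n; split=> //; rewrite -((hs x).1 n).
  by right; split => //; rewrite -((hs x).2 nP).
move=> [[n [Dn Bn]]|[nP Bx]]; first by rewrite ((hs x).1 n).
by rewrite ((hs x).2 nP).
Qed.

Section moves.
Context {d : measure_display} {X : measurableType d}.
Variables (e : X -> nat -> bool) (G : set (X * X)).
Hypothesis ecoding : coding e.
Hypothesis hG : borel_graph G.
Hypothesis hlf : locally_finite G.

Definition has_nbr_in (W : set X) : set X := [set x | exists y, G (x, y) /\ W y].

Lemma measurable_has_nbr_in W : measurable W -> measurable (has_nbr_in W).
Proof.
move=> mW; have [mG _ _] := hG.
rewrite (_ : has_nbr_in W = [set x | exists y, (G `&` (setT `*` W)) (x, y)]).
  apply: (measurable_proj ecoding).
    by apply: measurableI => //; exact: measurableX.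
  by move=> x; apply: sub_finite_set (hlf x) => y [].
by apply/seteqP; split=> x [y []]; [exists y|move=> ? [_ ?]; exists y].
Qed.

(** Uniqueness of the neighbour is expressed by saying that no coordinate set
    separates two neighbours, which makes the set measurable. *)
Definition single_nbr_in W : set X := has_nbr_in W `&`
  [set x | forall n, (~` (has_nbr_in (W `&` [set y | e y n]) `&`
                          has_nbr_in (W `&` ~` [set y | e y n]))) x].

Lemma measurable_single_nbr_in W : measurable W -> measurable (single_nbr_in W).
Proof.
have mU := measurable_coord ecoding.
move=> mW; apply: measurableI; first exact: measurable_has_nbr_in.
apply: measurable_forall => n; apply/measurableC/measurableI;
  apply/measurable_has_nbr_in/measurableI => //; exact: measurableC.
Qed.

Lemma single_nbr_uniq W x y y' : single_nbr_in W x -> G (x, y) -> W y ->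
  G (x, y') -> W y' -> y = y'.
Proof.
move=> [_ h] Gy Wy Gy' Wy'; apply: (coding_inj ecoding); apply/funext => n.
apply: contrapT => yy'; apply: (h n).
case E: (e y n) yy'; case E': (e y' n) => // _.
  by split; [exists y|exists y'; split=> //; split=> //=; rewrite E'].
by split; [exists y'|exists y; split=> //; split=> //=; rewrite E].
Qed.

Definition nbr_in (W : set X) (x : X) : X :=
  if `[< single_nbr_in W x >] then xget x [set y | G (x, y) /\ W y] else x.

Lemma nbr_inP W x : single_nbr_in W x -> G (x, nbr_in W x) /\ W (nbr_in W x).
Proof.
move=> h; rewrite /nbr_in; case: asboolP => // -[[y hy] _].
by have := @xgetI _ x [set y | G (x, y) /\ W y] _ hy.
Qed.

Lemma measurable_nbr_in W : measurable W -> measurable_fun setT (nbr_in W).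
Proof.
have mU := measurable_coord ecoding.
move=> mW; apply: (measurable_fun_code ecoding) => n.
rewrite (_ : _ @^-1` _ = (single_nbr_in W `&` has_nbr_in (W `&` [set y | e y n])) `|`
  (~` single_nbr_in W `&` [set y | e y n])).
  apply: measurableU; apply: measurableI => //.
  - exact: measurable_single_nbr_in.
  - by apply/measurable_has_nbr_in/measurableI.
  - exact/measurableC/measurable_single_nbr_in.
apply/seteqP; split=> x; rewrite /preimage /=.
  move=> en; have [h|h] := pselect (single_nbr_in W x); last first.
    by right; split => //; move: en; rewrite /nbr_in; case: asboolP.
  by left; split=> //; have [? ?] := nbr_inP h; exists (nbr_in W x).
move=> [[h [y [Gy [Wy yn]]]]|[h xn]]; last by rewrite /nbr_in; case: asboolP.
by have [Gn Wn] := nbr_inP h; rewrite (single_nbr_uniq h Gn Wn Gy Wy).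
Qed.

(** A Lusin-Novikov enumeration of the graph; the functions are made total by
    letting points outside the domain stay fixed. *)
Definition moves (f : nat -> X -> X) :=
  [/\ forall j, measurable_fun setT (f j),
      forall j x, f j x = x \/ G (x, f j x) &
      forall x y, G (x, y) -> exists j, f j x = y].

(** A neighbour is isolated from the finitely many others by a cylinder,
    hence is the unique neighbour in some member of a countable family of
    sets. *)
Lemma moves_exist : exists f, moves f.
Proof.
pose W n := e @^-1` cyl (odflt [::] (@pickle_inv (seq bool) n)).
have mW n : measurable (W n) by apply/(measurable_code_preimage ecoding)/borelC_cyl.
exists (fun n => nbr_in (W n)); split.
- by move=> n; exact: measurable_nbr_in.
- move=> n x; have [/nbr_inP[]|h] := pselect (single_nbr_in (W n) x); first by right.
  by left; rewrite /nbr_in; case: asboolP.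
move=> x y Gxy.
have [k hk] : exists k, forall y', G (x, y') -> y' <> y -> ~ agree k (e y') (e y).
  apply: (@finite_uniform _ [set y' | G (x, y')]
    (fun k y' => y' <> y -> ~ agree k (e y') (e y))) => //.
    by move=> k l t kl h /h; apply: contra_not => /(agree_le kl).
  move=> y' /= Gy'; have [->|yy'] := eqVneq y y'; first by exists 0%N.
  suff [k hk] : exists k, ~ agree k (e y') (e y) by exists k.
  apply/existsNP => ag; move/eqP: yy'; apply; apply: (coding_inj ecoding).
  by apply/funext => i; rewrite (ag i.+1).
exists (pickle (mkseq (e y) k)); set n := pickle _.
have WE y' : W n y' <-> agree k (e y') (e y).
  rewrite /W /n pickleK_inv /preimage /cyl /= size_mkseq; split.
    exact: mkseq_agree.
  by move=> h; apply/eq_in_map => i; rewrite mem_iota => /andP[_ /h].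
have Wy : W n y by apply/WE.
have Wuniq y' : G (x, y') -> W n y' -> y' = y.
  by move=> Gy' /WE ag; apply: contrapT => /(hk _ Gy').
have h : single_nbr_in (W n) x.
  split; first by exists y.
  move=> m [[y1 [G1 [W1 e1]]] [y2 [G2 [W2 e2]]]]; apply: e2.
  by rewrite (Wuniq _ G2 W2) -(Wuniq _ G1 W1).
have [? ?] := nbr_inP h; exact: Wuniq.
Qed.

End moves.

(** * Connectedness relations of induced subgraphs *)

Section induced.
Context {d : measure_display} {X : measurableType d}.
Variables (G : set (X * X)).
Implicit Types A B K : set X.

Definition induced_rel A : set (X * X) := conn_rel A (restr G A).

Lemma induced_rel_setT : induced_rel setT = conn_rel setT G.
Proof. by rewrite /induced_rel /restr setXTT setIT. Qed.

Lemma induced_rel_sub A x y : induced_rel A (x, y) -> A x /\ A y.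
Proof. by case. Qed.

Lemma induced_rel_refl A x : A x -> induced_rel A (x, x).
Proof. by move=> Ax; split=> //; exact: rt_refl. Qed.

Lemma induced_rel_edge A x y : A x -> A y -> G (x, y) -> induced_rel A (x, y).
Proof. by move=> Ax Ay Gxy; split=> //; apply: rt_step; split. Qed.

Lemma induced_rel_trans A x y z :
  induced_rel A (x, y) -> induced_rel A (y, z) -> induced_rel A (x, z).
Proof. by move=> [Ax Ay xy] [_ Az yz]; split=> //=; exact: rt_trans yz. Qed.

Lemma induced_rel_ind A (P : X -> Prop) :
  (forall x y, A x -> A y -> G (x, y) -> P x -> P y) ->
  forall x y, induced_rel A (x, y) -> P x -> P y.
Proof.
move=> hP x y [_ _ /=]; elim=> // {x y} => [x y [/= Gxy [/= Ax Ay]]|x y z _ ih1 _ ih2 Px].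
  exact: hP.
by apply: ih2; exact: ih1.
Qed.

Lemma induced_relS A B x y : A `<=` B -> induced_rel A (x, y) ->
  induced_rel B (x, y).
Proof.
move=> AB Axy; have [Ax _] := induced_rel_sub Axy.
apply: (@induced_rel_ind A (fun y => induced_rel B (x, y)) _ _ _ Axy).
  move=> u v Au Av Guv xu; apply: induced_rel_trans xu _.
  by apply: induced_rel_edge => //; exact: AB.
by apply: induced_rel_refl; exact: AB.
Qed.

Hypothesis Gsym : forall x y, G (x, y) -> G (y, x).

Lemma induced_rel_sym A x y : induced_rel A (x, y) -> induced_rel A (y, x).
Proof.
move=> Axy; have [Ax _] := induced_rel_sub Axy.
apply: (@induced_rel_ind A (fun y => induced_rel A (y, x)) _ _ _ Axy).
  move=> u v Au Av Guv xu; apply: induced_rel_trans xu.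
  by apply: induced_rel_edge => //; exact: Gsym.
exact: induced_rel_refl.
Qed.

(** B is a union of components of the graph induced on A; when A is the whole
    space, B is invariant. *)
Definition saturated A B := forall x y, B x -> A y -> G (x, y) -> B y.

Lemma saturated_rel A B x y : saturated A B -> induced_rel A (x, y) -> B x -> B y.
Proof. by move=> sat; apply: induced_rel_ind => u v _ Av Guv Bu; exact: sat Guv. Qed.

Lemma saturated_induced A B x y : saturated A B -> induced_rel A (x, y) ->
  B x -> induced_rel B (x, y).
Proof.
move=> sat xy Bx.
apply: (@induced_rel_ind A (fun y => induced_rel B (x, y)) _ _ _ xy).
  move=> u v Au Av Guv xu; have [_ Bu] := induced_rel_sub xu.
  apply: induced_rel_trans xu _.
  by apply: induced_rel_edge => //; exact: sat Guv.
exact: induced_rel_refl.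
Qed.

Lemma rel_saturated A B : (forall x y, induced_rel A (x, y) -> B x -> B y) ->
  B `<=` A -> saturated A B.
Proof.
by move=> h BA x y Bx Ay Gxy; apply: (h x y) => //; apply: induced_rel_edge => //; exact: BA.
Qed.

Lemma saturatedC A B : saturated A B -> saturated A (A `\` B).
Proof.
move=> sat x y [Ax nB] Ay Gxy; split=> // By; apply: nB.
by apply: sat By Ax _; exact: Gsym.
Qed.

End induced.

Section words.
Context {d : measure_display} {X : measurableType d}.
Variables (e : X -> nat -> bool) (G : set (X * X)) (f : nat -> X -> X).
Hypothesis ecoding : coding e.
Hypothesis Gsym : forall x y, G (x, y) -> G (y, x).
Hypothesis fmoves : moves G f.
Implicit Types A B K : set X.

Definition move_in A j x :=
  if `[< A x /\ A (f j x) >] then f j x else x.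

(** Words in the moves that stay in A; a number that codes no word stands for
    the empty one. *)
Definition word A n x :=
  foldl (fun x j => move_in A j x) x (odflt [::] (@pickle_inv (seq nat) n)).

Lemma measurable_word A n : measurable A -> measurable_fun setT (word A n).
Proof.
move=> mA; have [mf _ _] := fmoves; rewrite /word; case: pickle_inv => [s|] /=; last exact: measurable_id.
elim/last_ind: s => [|s j ih]; first exact: measurable_id.
under eq_fun do rewrite -cats1 foldl_cat /=.
have mj : measurable_fun setT (move_in A j).
  apply: measurable_fun_piecewise => //.
  by apply: measurableI => //; exact: measurable_preimage.
exact: (measurableT_comp mj ih).
Qed.

Lemma induced_relP A x y : induced_rel G A (x, y) <-> A x /\ exists n, word A n x = y.
Proof.
have [_ fG Gf] := fmoves; split=> [xy|[Ax [n <-]]].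
  have [Ax _] := induced_rel_sub xy; split=> //.
  apply: (@induced_rel_ind _ _ G A (fun y => exists n, word A n x = y) _ _ _ xy).
    move=> u v Au Av Guv [n nu].
    have [j fj] := Gf _ _ Guv.
    exists (pickle (rcons (odflt [::] (@pickle_inv (seq nat) n)) j)).
    rewrite /word pickleK_inv /= -cats1 foldl_cat /= -/(word A n x) nu.
    by rewrite /move_in fj; case: asboolP => // -[]; split.
  by exists (pickle ([::] : seq nat)); rewrite /word pickleK_inv.
rewrite /word; case: pickle_inv => [s|] /=; last exact: induced_rel_refl.
elim/last_ind: s => [|s j ih]; first exact: induced_rel_refl.
rewrite -cats1 foldl_cat /=; set u := foldl _ _ _ in ih *.
have [_ Au] := induced_rel_sub ih; apply: induced_rel_trans ih _.
rewrite /move_in.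
have [ux|uG] := fG j u.
  by rewrite ux if_same; exact: induced_rel_refl.
case: asboolP => [[? ?]|_]; first exact: induced_rel_edge.
exact: induced_rel_refl.
Qed.

Lemma word_rel A n x : A x -> induced_rel G A (x, word A n x).
Proof. by move=> Ax; apply/induced_relP; split=> //; exists n. Qed.

Lemma word_in A n x : A x -> A (word A n x).
Proof. by move=> Ax; have [] := induced_rel_sub (word_rel n Ax). Qed.

Lemma measurable_graph (h : X -> X) : measurable_fun setT h ->
  measurable [set p : X * X | h p.1 = p.2].
Proof.
move=> mh; apply: (measurable_eq_fun ecoding (h1 := fun p : X * X => h p.1)).
  exact: (measurableT_comp mh measurable_fst).
exact: measurable_snd.
Qed.

Lemma measurable_induced_rel A : measurable A -> measurable (induced_rel G A).
Proof.
move=> mA; rewrite (_ : induced_rel G A =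
  (A `*` setT) `&` [set p | exists n, [set p : X * X | word A n p.1 = p.2] p]).
  apply: measurableI; first exact: measurableX.
  by apply: measurable_exists => n; apply: measurable_graph; exact: measurable_word.
apply/seteqP; split=> [[x y] /induced_relP[Ax h]|[x y] [[/= Ax _] h]]; first by split.
exact/induced_relP.
Qed.

Lemma borel_equivalence_induced A : measurable A ->
  borel_equivalence A (induced_rel G A).
Proof.
move=> mA; split.
- exact: measurable_induced_rel.
- by move=> [x y] xy; have := induced_rel_sub xy.
- by move=> x; exact: induced_rel_refl.
- by move=> x y; exact: induced_rel_sym.
- by move=> x y z; exact: induced_rel_trans.
Qed.

Definition saturation A B : set X := [set x | exists2 y, B y & induced_rel G A (x, y)].

Lemma measurable_saturation A B : measurable A -> measurable B ->
  measurable (saturation A B).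
Proof.
move=> mA mB; rewrite (_ : saturation A B = A `&` [set x | exists n, B (word A n x)]).
  apply: measurableI => //; apply: measurable_exists => n.
  by apply: measurable_preimage => //; exact: measurable_word.
apply/seteqP; split=> [x [y By /induced_relP[Ax [n ny]]]|x [Ax [n Bn]]].
  by split=> //; exists n; rewrite ny.
by exists (word A n x) => //; exact: word_rel.
Qed.

Lemma saturation_rel A B x y : induced_rel G A (x, y) -> saturation A B x ->
  saturation A B y.
Proof.
move=> xy [z Bz xz]; exists z => //.
by apply: induced_rel_trans xz; exact: induced_rel_sym.
Qed.

Lemma saturation_sub A B : saturation A B `<=` A.
Proof. by move=> x [y _ xy]; have [] := induced_rel_sub xy. Qed.

Lemma saturated_saturation A B : saturated G A (saturation A B).
Proof. by apply: rel_saturated; [exact: saturation_rel|exact: saturation_sub]. Qed.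

Lemma sub_saturation A B : B `<=` A -> B `<=` saturation A B.
Proof. by move=> BA x Bx; exists x => //; apply: induced_rel_refl; exact: BA. Qed.

(** The domain on which one word undoes another, hence on which the first is
    injective.  These partial injections cover the relation. *)
Definition pinj A n : set X :=
  A `&` [set x | word A (ndecode n).2 (word A (ndecode n).1 x) = x].

Lemma measurable_pinj A n : measurable A -> measurable (pinj A n).
Proof.
move=> mA; apply: measurableI => //.
apply: (measurable_eq_fun ecoding); last exact: measurable_id.
by apply: (measurableT_comp (measurable_word _ mA)); exact: measurable_word.
Qed.

Lemma pinjP A x y : induced_rel G A (x, y) ->
  exists2 n, pinj A n x & word A (ndecode n).1 x = y.
Proof.
move=> xy; have [Ax _] := induced_rel_sub xy.
have /induced_relP[_ [i ixy]] := xy.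
have /(induced_rel_sym Gsym)/induced_relP[_ [j jyx]] := xy.
by exists (ncode i j); rewrite /pinj /= ?ncodeK //=; split=> //=; rewrite ixy jyx.
Qed.

(** The image of D under the first word, written as a preimage under the
    second one so that it is visibly measurable. *)
Definition pinj_image A n (D : set X) : set X :=
  A `&` [set y | D (word A (ndecode n).2 y) /\
                 word A (ndecode n).1 (word A (ndecode n).2 y) = y].

Lemma measurable_pinj_image A n D : measurable A -> measurable D ->
  measurable (pinj_image A n D).
Proof.
move=> mA mD; apply: measurableI => //; apply: measurableI.
  by apply: measurable_preimage => //; exact: measurable_word.
apply: (measurable_eq_fun ecoding); last exact: measurable_id.
by apply: (measurableT_comp (measurable_word _ mA)); exact: measurable_word.
Qed.

Lemma pinj_bij A n D : D `<=` pinj A n ->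
  set_bij D (pinj_image A n D) (word A (ndecode n).1).
Proof.
move=> Dn; split.
- move=> x Dx; have [Ax /= xx] := Dn _ Dx; split; first exact: word_in.
  by rewrite /= xx.
- move=> x y /set_mem/Dn[_ /= xx] /set_mem/Dn[_ /= yy] xy.
  by rewrite -xx xy yy.
- by move=> y [Ay [Dy yy]]; exists (word A (ndecode n).2 y).
Qed.

End words.

(** * Real-valued probabilities of sets *)

Local Open Scope ring_scope.

Section mass.
Context {d : measure_display} {X : measurableType d} {R : realType}.
Variable mu : probability X R.
Implicit Types A B : set X.

Definition mass A : R := fine (mu A).

Lemma massE A : measurable A -> mu A = (mass A)%:E.
Proof. by move=> mA; rewrite /mass fineK//; exact: fin_num_measure. Qed.

Lemma mass_ge0 A : 0 <= mass A. Proof. exact: fine_ge0. Qed.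

Lemma mass0 : mass set0 = 0. Proof. by rewrite /mass measure0. Qed.

Lemma massT : mass setT = 1. Proof. by rewrite /mass probability_setT. Qed.

Lemma le_mass A B : measurable A -> measurable B -> A `<=` B -> mass A <= mass B.
Proof.
by move=> mA mB AB; rewrite -lee_fin -!massE//; apply: le_measure; rewrite ?inE.
Qed.

Lemma massU A B : measurable A -> measurable B -> A `&` B = set0 ->
  mass (A `|` B) = mass A + mass B.
Proof.
move=> mA mB AB; apply: EFin_inj; rewrite EFinD -!massE//; last exact: measurableU.
by rewrite measureU.
Qed.

Lemma mass_split A B : measurable A -> measurable B ->
  mass A = mass (A `&` B) + mass (A `\` B).
Proof.
move=> mA mB; rewrite -massU ?setUIDK//.
- exact: measurableI.
- exact: measurableD.
- by rewrite -subset0 => x [[_ Bx] [_ /(_ Bx)]].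
Qed.

Lemma massUle A B : measurable A -> measurable B ->
  mass (A `|` B) <= mass A + mass B.
Proof.
move=> mA mB; have mBA : measurable (B `\` A) by exact: measurableD.
rewrite (_ : A `|` B = A `|` (B `\` A)).
  rewrite massU//; first by rewrite lerD2l; apply: le_mass => // x [].
  by rewrite -subset0 => x [Ax [_]]; apply.
apply/seteqP; split=> x [Ax|]; [by left| |by left|by move=> []; right].
by have [Ax|] := pselect (A x); [left|right].
Qed.

Lemma le_massU A B C : measurable A -> measurable B -> measurable C ->
  A `<=` B `|` C -> mass A <= mass B + mass C.
Proof.
move=> mA mB mC ABC; apply: le_trans (massUle mB mC).
by apply: le_mass => //; exact: measurableU.
Qed.

Lemma mass_bigcup_le (F : nat -> set X) (eps : R) : (forall n, measurable (F n)) ->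
  0 <= eps -> (forall n, mass (F n) <= eps / (2 ^ n.+1)%:R) ->
  mass (\bigcup_n F n) <= eps.
Proof.
move=> mF eps0 h; rewrite -lee_fin -massE; last exact: bigcupT_measurable.
have mF' : measurable (\bigcup_n F n) by exact: bigcupT_measurable.
apply: (@le_trans _ _ (\sum_(0 <= n <oo) mu (F n))%E).
  by apply: measure_sigma_subadditive.
apply: le_trans (epsilon_trick0 _ eps0).
by apply: lee_nneseries => [n _ _|n _]; [exact: measure_ge0|rewrite massE// lee_fin].
Qed.

Lemma mass_bigcup0 (F : nat -> set X) : (forall n, measurable (F n)) ->
  (forall n, mass (F n) = 0) -> mass (\bigcup_n F n) = 0.
Proof.
move=> mF F0; apply/eqP; rewrite eq_le mass_ge0 andbT.
by apply: mass_bigcup_le => // n; rewrite F0 mul0r.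
Qed.

Lemma mass_bigcup_eq (F F' : nat -> set X) : (forall n, measurable (F n)) ->
  (forall n, measurable (F' n)) -> trivIset setT F -> trivIset setT F' ->
  (forall n, mass (F n) = mass (F' n)) -> mass (\bigcup_n F n) = mass (\bigcup_n F' n).
Proof.
move=> mF mF' tF tF' FF'; rewrite /mass !measure_bigcup//; congr fine.
apply: eq_eseriesr => n _.
exact: (etrans (massE (mF n)) (etrans (congr1 EFin (FF' n)) (esym (massE (mF' n))))).
Qed.

Lemma mass_tail (F : nat -> set X) (eps : R) : (forall n, measurable (F n)) ->
  (forall n, F n `<=` F n.+1) -> 0 < eps ->
  exists n, mass (\bigcup_n F n `\` F n) < eps.
Proof.
move=> mF ndF eps0; pose H n := \bigcup_k F k `\` F n.
have mH n : measurable (H n) by apply: measurableD => //; exact: bigcupT_measurable.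
have : mu (H n) @[n --> \oo] --> mu (\bigcap_n H n).
  apply: nonincreasing_cvg_mu => //.
  - by rewrite ltey_eq fin_num_measure.
  - exact: bigcapT_measurable.
  - by apply/nonincreasing_seqP => n; apply/subsetPset => x [? nF]; split=> // /ndF.
rewrite (_ : \bigcap_n H n = set0); last first.
  rewrite -subset0 => x h; have [[n _ Fn] _] := h 0%N I.
  by have [_] := h n I; apply.
rewrite measure0 => /fine_cvgP[_] /cvgrPdist_lt/(_ _ eps0)[n _ /(_ _ (leqnn n))] /=.
rewrite sub0r normrN => h; exists n; apply: le_lt_trans h.
exact: ler_norm.
Qed.

(** The reverse Fatou inequality for sets. *)
Lemma mass_limsup (F : nat -> set X) (k : R) : (forall n, measurable (F n)) ->
  (forall n, k <= mass (F n)) ->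
  k <= mass (\bigcap_n \bigcup_i F (n + i)%N).
Proof.
move=> mF kF; pose H n := \bigcup_i F (n + i)%N.
have mH n : measurable (H n) by exact: bigcupT_measurable.
have mcapH : measurable (\bigcap_n H n) by exact: bigcapT_measurable.
apply/ler_addgt0Pr => eps eps0.
have [||n hn] := @mass_tail (fun n => ~` H n) eps _ _ eps0.
- by move=> n; exact: measurableC.
- move=> n x; apply: contra_not => -[i _ Fi]; exists i.+1 => //.
  by rewrite addnS.
apply: le_trans (kF n) _.
have -> : mass (\bigcap_n H n) + eps = eps + mass (\bigcap_n H n) by rewrite addrC.
apply: le_trans (lerD (ltW hn) (lexx _)); apply: le_massU => //.
  by apply: measurableD; [apply: bigcupT_measurable => i|]; exact: measurableC.
move=> x Fx; have [h|h] := pselect ((\bigcap_n H n) x); [by right|left].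
split; first by move: h; rewrite -[X in ~ X x -> _]setCK setC_bigcap => /contrapT.
by apply; exists 0%N => //; rewrite addn0.
Qed.

Lemma mass_gt0_bigcup (F : nat -> set X) B : (forall n, measurable (F n)) ->
  measurable B -> B `<=` \bigcup_n F n -> 0 < mass B -> exists n, 0 < mass (B `&` F n).
Proof.
move=> mF mB BF B0; apply: contrapT => /forallNP h; move: B0; rewrite ltNge => /negP; apply.
have mBF n : measurable (B `&` F n) by exact: measurableI.
rewrite -(@mass_bigcup0 (fun n => B `&` F n))//.
  apply: le_mass => //; first exact: bigcupT_measurable.
  by move=> x Bx; have [n _ Fn] := BF _ Bx; exists n.
by move=> n; apply/eqP; rewrite eq_le mass_ge0 andbT leNgt; apply/negP.
Qed.

Lemma mass_sub0 A B : measurable A -> measurable B -> A `<=` B -> mass B = 0 -> mass A = 0.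
Proof.
by move=> mA mB AB B0; apply/eqP; rewrite eq_le mass_ge0 andbT -B0; exact: le_mass.
Qed.

End mass.

(** * Almost finite sets and hyperfiniteness *)

Section hfin.
Context {d : measure_display} {X : measurableType d} {R : realType}.
Variables (mu : probability X R).
Variables (e : X -> nat -> bool) (G : set (X * X)) (f : nat -> X -> X).
Hypothesis ecoding : coding e.
Hypothesis Gsym : forall x y, G (x, y) -> G (y, x).
Hypothesis hlf : locally_finite G.
Hypothesis fmoves : moves G f.
Implicit Types A B K : set X.
Local Notation mass := (mass mu).

Definition fincomp K := finite_components K (restr G K).

Lemma fincompS K K' : K' `<=` K -> fincomp K -> fincomp K'.
Proof.
move=> KK' fK x /KK'/fK; apply: sub_finite_set => y /=.
exact: induced_relS.
Qed.

(** Components do not leave saturated sets. *)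
Lemma fincomp_local L :
  (forall x, L x -> exists S, [/\ saturated G L S, S x & fincomp S]) -> fincomp L.
Proof.
move=> h x /h[S [satS Sx /(_ _ Sx)]]; apply: sub_finite_set => y /= xy.
exact: saturated_induced satS xy Sx.
Qed.

Lemma fincompU K1 K2 : fincomp K1 -> fincomp K2 ->
  (forall x y, K1 x -> K2 y -> ~ G (x, y)) -> fincomp (K1 `|` K2).
Proof.
move=> f1 f2 noE; apply: fincomp_local => x [K1x|K2x].
  by exists K1; split=> // u v K1u [//|K2v] /(noE _ _ K1u K2v).
by exists K2; split=> // u v K2u [K1v|//] /Gsym/(noE _ _ K1v K2u).
Qed.

Definition almost_finite A := forall eps : R, 0 < eps ->
  exists K, [/\ measurable K, K `<=` A, fincomp K & mass (A `\` K) < eps].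

Lemma almost_finiteS A A' : measurable A -> measurable A' -> A' `<=` A ->
  almost_finite A -> almost_finite A'.
Proof.
move=> mA mA' AA' hA eps /hA[K [mK KA fK ltK]]; exists (K `&` A'); split.
- exact: measurableI.
- by move=> x [].
- by apply: fincompS fK => x [].
- apply: le_lt_trans ltK; apply: le_mass; do ?exact: measurableD.
    by apply: measurableD => //; exact: measurableI.
  by move=> x [A'x nK]; split=> [|Kx]; [exact: AA'|apply: nK].
Qed.

Lemma almost_finite0 A : measurable A -> mass A = 0 -> almost_finite A.
Proof.
by move=> mA A0 eps eps0; exists set0; split=> //; rewrite setD0 A0.
Qed.

Lemma almost_finite_approx A : measurable A ->
  (forall eps : R, 0 < eps -> exists B,
     [/\ measurable B, B `<=` A, almost_finite B & mass (A `\` B) < eps]) ->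
  almost_finite A.
Proof.
move=> mA h eps eps0; have e20 : 0 < eps / 2 by rewrite divr_gt0.
have [B [mB BA hB ltB]] := h _ e20; have [K [mK KB fK ltK]] := hB _ e20.
exists K; split=> //; first exact: subset_trans BA.
apply: (@le_lt_trans _ _ (mass (A `\` B) + mass (B `\` K))); last by lra.
apply: le_massU; do ?exact: measurableD.
by move=> x [Ax nK]; have [|] := pselect (B x); [right|left].
Qed.

Lemma almost_finite_bigcup (F : nat -> set X) : (forall n, measurable (F n)) ->
  (forall n, F n `<=` F n.+1) -> (forall n, almost_finite (F n)) ->
  almost_finite (\bigcup_n F n).
Proof.
move=> mF ndF hF; apply: almost_finite_approx; first exact: bigcupT_measurable.
move=> eps eps0; have [n hn] := mass_tail mu mF ndF eps0.
by exists (F n); split=> // x Fx; exists n.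
Qed.

(** Outside the saturated set B1 nothing of B2 is adjacent to it, so
    approximations of B1 and of B2 minus B1 can be joined. *)
Lemma almost_finiteU A B1 B2 : measurable B1 -> measurable B2 -> B1 `<=` A ->
  B2 `<=` A -> saturated G A B1 ->
  almost_finite B1 -> almost_finite B2 -> almost_finite (B1 `|` B2).
Proof.
move=> mB1 mB2 B1A B2A sat h1 h2 eps eps0.
have e20 : 0 < eps / 2 by rewrite divr_gt0.
have [K1 [mK1 K1B f1 lt1]] := h1 _ e20; have [K2 [mK2 K2B f2 lt2]] := h2 _ e20.
exists (K1 `|` (K2 `\` B1)); split.
- by apply: measurableU => //; exact: measurableD.
- by move=> x [/K1B|[/K2B ? _]]; [left|right].
- apply: fincompU => //; first by apply: fincompS f2 => x [].
  move=> x y /K1B B1x [/K2B/B2A Ay nB1y] Gxy; apply: nB1y.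
  exact: sat Gxy.
apply: (@le_lt_trans _ _ (mass (B1 `\` K1) + mass (B2 `\` K2))); last by lra.
apply: le_massU; do ?exact: measurableD.
  apply: measurableD; apply: measurableU => //; exact: measurableD.
move=> x [B12 /not_orP[nK1 nK2]]; have [B1x|nB1] := pselect (B1 x); first by left.
by right; case: B12 => // B2x; split=> // K2x; apply: nK2.
Qed.

(** Finite relations pull back to finite relations along injections. *)
Lemma hyperfinite_pullback (B C : set X) (E E' : set (X * X)) (h : X -> X) :
  measurable C -> borel_equivalence C E' -> measurable_fun setT h ->
  (forall y, C y -> B (h y)) -> {in C &, injective h} ->
  (forall x y, E' (x, y) -> E (h x, h y)) -> hyperfinite B E -> hyperfinite C E'.
Proof.
move=> mC bE' mh CB hinj E'E [bE [F [bF finF ndF EF]]]; split=> //.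
have [mE' E'C E'refl E'sym E'trans] := bE'.
exists (fun n => E' `&` [set p | F n (h p.1, h p.2)]); split.
- move=> n; have [mF FB Frefl Fsym Ftrans] := bF n; split.
  + apply: measurableI => //; apply: measurable_preimage mF.
    apply/measurable_fun_pairP; split => /=.
      exact: (measurableT_comp mh measurable_fst).
    exact: (measurableT_comp mh measurable_snd).
  + by move=> p [/E'C].
  + by move=> x Cx; split; [exact: E'refl|apply: Frefl; exact: CB].
  + by move=> x y [/E'sym ? /Fsym].
  + by move=> x y z [xy xyF] [yz yzF]; split; [exact: E'trans yz|exact: Ftrans yzF].
- move=> n x; have [Cx|nCx] := pselect (C x); last first.
    by apply: (sub_finite_set (B := set0)) => // y [/E'C[]].
  apply: (sub_finite_set (B := C `&` [set y | F n (h x, h y)])).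
    by move=> y [/E'C[/= _ Cy] Fy].
  have injC : {in C `&` [set y | F n (h x, h y)] &, injective h}.
    by move=> u v /set_mem[Cu _] /set_mem[Cv _]; apply: hinj; exact/mem_set.
  rewrite -(eq_finite_set (inj_card_eq injC)).
  by apply: (sub_finite_set (B := [set z | F n (h x, z)])) => // _ [y [_ Fy] <-].
- by move=> n p [Ep /ndF].
- apply/seteqP; split=> [[x y] xy|p [n _ []]//].
  by have := E'E _ _ xy; rewrite EF => -[n _ Fn]; exists n.
Qed.

Lemma hyperfiniteS (B C : set X) (E E' : set (X * X)) : measurable C ->
  borel_equivalence C E' -> C `<=` B -> E' `<=` E -> hyperfinite B E -> hyperfinite C E'.
Proof.
move=> mC bE' CB E'E; apply: (@hyperfinite_pullback B C E E' id) => //.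
by move=> x y /E'E.
Qed.

Lemma borel_equivalence_restr A B : measurable A -> measurable B -> B `<=` A ->
  borel_equivalence B (restr (induced_rel G A) B).
Proof.
move=> mA mB BA.
have [mE EA Erefl Esym Etrans] := borel_equivalence_induced ecoding Gsym fmoves mA.
split.
- by apply: measurableI => //; exact: measurableX.
- by move=> p [].
- by move=> x Bx; split=> //; apply: Erefl; exact: BA.
- by move=> x y [/Esym ? []].
- by move=> x y z [xy [? ?]] [yz [? ?]]; split=> //; exact: Etrans yz.
Qed.

Lemma induced_rel_bigcup (F : nat -> set X) : (forall n, F n `<=` F n.+1) ->
  induced_rel G (\bigcup_n F n) = \bigcup_n induced_rel G (F n).
Proof.
move=> ndF; have ndF' m n : (m <= n)%N -> F m `<=` F n.
  move=> mn; rewrite -(subnK mn); elim: (n - m)%N => // k ih.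
  by rewrite addSn; exact: subset_trans (ndF _).
apply/seteqP; split=> [[x y] xy|[x y] [n _]]; last first.
  by apply: induced_relS => z Fz; exists n.
have [[n0 _ Fx] _] := induced_rel_sub xy.
apply: (@induced_rel_ind _ _ G _ (fun y => (\bigcup_n induced_rel G (F n)) (x, y)) _ _ _ xy).
  move=> u v _ [m _ Fv] Guv [n _ xu]; exists (maxn m n) => //.
  have Fn := ndF' _ _ (leq_maxr m n); have Fm := ndF' _ _ (leq_maxl m n).
  apply: induced_rel_trans (induced_relS Fn xu) _.
  have [_ Fu] := induced_rel_sub xu.
  by apply: induced_rel_edge => //; [exact: Fn|exact: Fm].
by exists n0 => //; exact: induced_rel_refl.
Qed.

(** A finite path in the union lies in one of the sets. *)
Lemma hyperfinite_bigcup (F : nat -> set X) : (forall n, measurable (F n)) ->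
  (forall n, F n `<=` F n.+1) -> (forall n, fincomp (F n)) ->
  hyperfinite (\bigcup_n F n) (induced_rel G (\bigcup_n F n)).
Proof.
move=> mF ndF fF; set B := \bigcup_n F n.
have mB : measurable B by exact: bigcupT_measurable.
split; first exact: (borel_equivalence_induced ecoding Gsym fmoves).
have FB n : F n `<=` B by move=> x Fx; exists n.
exists (fun n => induced_rel G (F n) `|` [set p | B p.1 /\ p.1 = p.2]); split.
- move=> n; split.
  + apply: measurableU; first exact: (measurable_induced_rel ecoding fmoves).
    apply: measurableI; first exact: (measurable_preimage measurable_fst).
    exact: (measurable_eq_fun ecoding measurable_fst measurable_snd).
  + move=> [x y] [xy|[/= Bx <-]]; last by split.
    by have [/FB ? /FB] := induced_rel_sub xy.
  + by move=> x Bx; right.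
  + by move=> x y [/(induced_rel_sym Gsym)|[/= Bx <-]]; [left|right].
  + move=> x y z [xy|[/= Bx ->]] [yz|[/= By <-]].
    * by left; exact: induced_rel_trans yz.
    * by left.
    * by left.
    * by right.
- move=> n x; apply: (sub_finite_set (B := [set y | induced_rel G (F n) (x, y)] `|` [set x])).
    by move=> y [xy|[/= _ <-]]; [left|right].
  rewrite finite_setU; split; last exact: finite_set1.
  have [/fF//|nF] := pselect (F n x).
  by apply: (sub_finite_set (B := set0)) => // y xy; have [] := induced_rel_sub xy.
- by move=> n [x y] [xy|h]; [left; apply: induced_relS xy|right].
- rewrite [LHS]induced_rel_bigcup//; apply/seteqP; split=> [p [n _ np]|[x y] [n _]].
    by exists n => //; left.
  move=> [xy|[/= [m _ Bx] <-]]; first by exists n.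
  by exists m => //; exact: induced_rel_refl.
Qed.

(** The points that belong to all approximations from some index on form a
    conull set by Borel-Cantelli, and an increasing union of sets with finite
    components. *)
Lemma almost_finite_hyperfinite A : measurable A -> almost_finite A ->
  exists B, [/\ measurable B, B `<=` A, mass (A `\` B) = 0 &
    hyperfinite B (induced_rel G B)].
Proof.
move=> mA hA.
have /choice[K hK] n : exists K, [/\ measurable K, K `<=` A, fincomp K &
    mass (A `\` K) < 2^-1 / (2 ^ n.+1)%:R].
  by apply: hA; rewrite divr_gt0// ltr0n expn_gt0.
have mK n : measurable (K n) by case: (hK n).
pose F n := \bigcap_k K (n + k)%N.
have mF n : measurable (F n) by exact: bigcapT_measurable.
have ndF n : F n `<=` F n.+1 by move=> x Fx k _; rewrite addSnnS; exact: Fx.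
exists (\bigcup_n F n); split.
- exact: bigcupT_measurable.
- by move=> x [n _ /(_ 0%N I)]; rewrite addn0; case: (hK n) => _ + _ _; apply.
- apply/eqP; rewrite eq_le mass_ge0 andbT; apply/ler_addgt0Pl => eps eps0.
  rewrite addr0.
  have [n hn] : exists n, 2^-1 / (2 ^ n)%:R <= eps.
    have [n _ /(_ n (leqnn n))] := near_infty_natSinv_expn_lt (PosNum eps0).
    rewrite /= => h; exists n; apply: ltW; apply: le_lt_trans h.
    by rewrite natrX ler_pM2r ?invr_gt0 ?exprn_gt0//; lra.
  have mAF m : measurable (A `\` K m) by exact: measurableD.
  apply: (@le_trans _ _ (mass (\bigcup_k (A `\` K (n + k)%N)))).
    apply: le_mass.
    + by apply: measurableD => //; exact: bigcupT_measurable.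
    + exact: bigcupT_measurable.
    move=> x [Ax nF]; apply: contrapT => h; apply: nF; exists n => // k _.
    by apply: contrapT => nK; apply: h; exists k.
  apply: le_trans hn; apply: mass_bigcup_le => [//||k].
    by rewrite divr_ge0// ler0n.
  have [_ _ _ /ltW h] := hK (n + k)%N; apply: le_trans h _.
  by rewrite -addnS expnD natrM invfM mulrA.
- apply: hyperfinite_bigcup => // n; case: (hK n) => _ _ fK _.
  by apply: fincompS fK => x /(_ 0%N I); rewrite addn0.
Qed.

(** A hyperfinite relation on B makes the whole saturation of B almost
    finite.  Points are sent into B by one of the first m partial injections,
    so that at most m points of the saturation have the same image; points
    whose neighbours have F n equivalent images then form a set with finite
    components. *)
Lemma hyperfinite_almost_finite A B : measurable A -> measurable B -> B `<=` A ->
  hyperfinite B (restr (induced_rel G A) B) -> almost_finite (saturation G A B).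
Proof.
move=> mA mB BA [_ [F [bF finF ndF EF]]].
have ndF' m n : (m <= n)%N -> F m `<=` F n.
  move=> mn; rewrite -(subnK mn); elim: (n - m)%N => // k ih.
  by rewrite addSn; exact: subset_trans (ndF _).
pose P n := pinj f A n `&` [set x | B (word f A (ndecode n).1 x)].
have mP n : measurable (P n).
  apply: measurableI; first exact: (measurable_pinj ecoding fmoves).
  by apply: measurable_preimage => //; exact: (measurable_word fmoves).
have [phi mphi hphi] := measurable_first_select mP
  (fun n => measurable_word fmoves (ndecode n).1 mA).
(* On Y m the selected injection is among the first m, so phi is at most m to
   one. *)
pose Y m := [set x | exists n : 'I_m, P n x].
have mY m : measurable (Y m) by exact: measurable_exists.
have YE m x : Y m x -> exists2 n : 'I_m, P n x & phi x = word f A (ndecode n).1 x.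
  move=> [n Pn]; have [|k Pk kmin] := @first_index (fun n => P n x).
    by exists n.
  have km : (k < m)%N.
    by apply: leq_ltn_trans (ltn_ord n); rewrite leqNgt; apply/negP => /kmin.
  by exists (Ordinal km) => //; exact: (hphi x).1.
have YA m x : Y m x -> induced_rel G A (x, phi x) /\ B (phi x).
  move=> /YE[n [[Ax _] Bn] ->]; split=> //.
  exact: (word_rel fmoves).
rewrite (_ : saturation _ _ _ = \bigcup_m Y m); last first.
  apply/seteqP; split=> [x [y By /(pinjP Gsym fmoves)[n nx ny]]|x [m _ /YA[xphi Bphi]]].
    by exists n.+1 => //; exists ord_max; split=> //=; rewrite ny.
  by exists (phi x).
apply: almost_finite_bigcup => //.
  by move=> m x [n Pn]; exists (widen_ord (leqnSn m) n).
move=> m.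
(* Local finiteness makes the sets K n exhaust Y m. *)
pose K n := Y m `&` [set x | forall j, Y m (f j x) -> F n (phi x, phi (f j x))].
have [mf fG Gf] := fmoves.
have mK n : measurable (K n).
  apply: measurableI => //; apply: measurable_forall => j.
  apply: measurable_imply; first exact: measurable_preimage.
  have [mF _ _ _ _] := bF n; apply: measurable_preimage mF.
  apply/measurable_fun_pairP; split => //=.
  exact: (measurableT_comp mphi (mf j)).
have -> : Y m = \bigcup_n K n.
  apply/seteqP; split=> [x Yx|x [n _ []//]].
  have [n' hn'] : exists k, forall y, ([set y | G (x, y)] `|` [set x]) y ->
      Y m y -> F k (phi x, phi y).
    apply: (@finite_uniform X _ (fun k y => Y m y -> F k (phi x, phi y))).
    - by rewrite finite_setU; split; [exact: hlf|exact: finite_set1].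
    - by move=> k l t kl + Yt => /(_ Yt); exact: ndF'.
    move=> y Gxy; have [Yy|nY] := pselect (Y m y); last by exists 0%N.
    suff [k hk] : exists k, F k (phi x, phi y) by exists k.
    have [xp Bx] := YA _ _ Yx; have [yp By] := YA _ _ Yy.
    have : restr (induced_rel G A) B (phi x, phi y).
      have [Ax _] := induced_rel_sub xp; have [Ay _] := induced_rel_sub yp.
      split=> //; apply: induced_rel_trans (induced_rel_sym Gsym xp) _.
      apply: induced_rel_trans yp.
      by case: Gxy => [|->]; [exact: induced_rel_edge|exact: induced_rel_refl].
    by rewrite EF => -[k _ Fk]; exists k.
  exists n' => //; split=> // j Yj; apply: hn' => //.
  by case: (fG j x) => [->|]; [right|left].
apply: almost_finite_bigcup => //.
  by move=> n x [Yx h]; split=> // j /h; exact: ndF.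
move=> n eps eps0; exists (K n); split=> //; last by rewrite setDv mass0.
move=> x Kx; have [_ FB Frefl Fsym Ftrans] := bF n.
have Yx : Y m x by case: Kx.
apply: (sub_finite_set (B := \bigcup_(k in [set k | (k < m)%N])
   [set word f A (ndecode k).2 z | z in [set z | F n (phi x, z)]])); last first.
  apply: bigcup_finite; first exact: finite_II.
  by move=> k _; apply: finite_image; exact: finF.
move=> y /= xy; have [_ [Yy _]] := induced_rel_sub xy.
have xyF : F n (phi x, phi y).
  apply: (@induced_rel_ind _ _ G (K n) (fun y => F n (phi x, phi y)) _ _ _ xy).
    move=> u v [Yu Ku] [Yv Kv] Guv xu; apply: Ftrans xu _.
    by have [j fj] := Gf _ _ Guv; rewrite -fj; apply: Ku; rewrite fj.
  by apply: Frefl; have [] := YA _ _ Yx.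
have [k [[Ay /= yk] _] phiy] := YE _ _ Yy.
exists k; first exact: ltn_ord.
by exists (phi y) => //; rewrite phiy yk.
Qed.

End hfin.

(** * Nowhere hyperfinite sets *)

Section nowhere.
Context {d : measure_display} {X : measurableType d} {R : realType}.
Variables (mu : probability X R).
Variables (e : X -> nat -> bool) (G : set (X * X)) (f : nat -> X -> X).
Hypothesis ecoding : coding e.
Hypothesis Gsym : forall x y, G (x, y) -> G (y, x).
Hypothesis hlf : locally_finite G.
Hypothesis fmoves : moves G f.
Implicit Types A B K : set X.
Local Notation mass := (mass mu).
Local Notation almost_finite := (almost_finite mu G).

(** The union of a sequence of sets in P whose measures approach the
    supremum. *)
Lemma exhaustion (P : set (set X)) : (forall B, P B -> measurable B) -> P set0 ->
  (forall B C, P B -> P C -> P (B `|` C)) ->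
  (forall F : nat -> set X, (forall n, P (F n)) -> (forall n, F n `<=` F n.+1) ->
     P (\bigcup_n F n)) ->
  exists2 B, P B & forall C, P C -> mass (C `\` B) = 0.
Proof.
move=> mP P0 PU Pbig; pose S := [set mass B | B in P].
have supS : has_sup S.
  split; first by exists (mass set0), set0.
  exists 1 => _ [B PB <-]; rewrite -(massT mu); apply: le_mass => //.
  exact: mP.
have /choice[B hB] n : exists B, P B /\ sup S - n.+1%:R^-1 < mass B.
  have n0 : 0 < n.+1%:R^-1 :> R by rewrite invr_gt0.
  have [_ [B PB <-] ltB] := sup_adherent n0 supS.
  by exists B.
pose F n := \big[setU/set0]_(i < n) B i.
have PF n : P (F n).
  elim: n => [|n ih]; rewrite /F; first by rewrite big_ord0.
  by rewrite big_ord_recr /=; apply: PU => //; case: (hB n).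
have ndF n : F n `<=` F n.+1 by rewrite /F big_ord_recr /=; left.
have PB := Pbig _ PF ndF; exists (\bigcup_n F n) => // C PC.
have PCB := PU _ _ PC PB.
apply/eqP; rewrite eq_le mass_ge0 andbT; apply/ler_addgt0Pl => eps eps0.
rewrite addr0.
have [n _ /(_ n (leqnn n)) /= hn] := near_infty_natSinv_lt (PosNum eps0).
have : mass (C `|` \bigcup_n F n) <= sup S.
  by apply: sup_upper_bound => //; exists (C `|` \bigcup_n F n).
have -> : C `|` \bigcup_n F n = (C `\` \bigcup_n F n) `|` \bigcup_n F n.
  by rewrite setUDl setDv setD0.
rewrite massU; last by rewrite setDKI.
- have : mass (B n) <= mass (\bigcup_n F n).
    apply: le_mass; [by apply: mP; case: (hB n)|exact: mP|].
    by move=> x Bx; exists n.+1 => //; rewrite /F big_ord_recr /=; right.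
  by have [_ ] := hB n; move: hn; move: (n.+1%:R^-1) => r; lra.
- by apply: measurableD; exact: mP.
- exact: mP.
Qed.

Definition nowhere A := nowhere_hyperfinite mu A (restr G A).

Lemma nowhereP A : nowhere A <-> forall B, measurable B -> B `<=` A ->
  hyperfinite B (restr (induced_rel G A) B) -> mass B = 0.
Proof.
split=> [nA B mB BA hB|h [B [mB BA B0 hB]]].
  apply/eqP; rewrite eq_le mass_ge0 andbT leNgt; apply/negP => B0; apply: nA.
  by exists B; split=> //; rewrite massE// lte_fin.
by move: B0; rewrite (massE mu mB) (h _ mB BA hB) ltxx.
Qed.

Lemma nowhere_null A : measurable A -> mass A = 0 -> nowhere A.
Proof. by move=> mA A0; apply/nowhereP => B mB BA _; exact: mass_sub0 A0. Qed.

(** A set that witnesses hyperfiniteness meets one of the sets in positive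
    measure, and hyperfiniteness passes to the smaller relation induced
    there. *)
Lemma nowhere_bigcup (F : nat -> set X) : (forall n, measurable (F n)) ->
  (forall n, nowhere (F n)) -> nowhere (\bigcup_n F n).
Proof.
move=> mF nF; apply/nowhereP => B mB BF hB.
apply/eqP; rewrite eq_le mass_ge0 andbT leNgt; apply/negP => B0.
have [n] := mass_gt0_bigcup mF mB BF B0; apply/negP; rewrite -leNgt.
have mBF : measurable (B `&` F n) by exact: measurableI.
have BFn : B `&` F n `<=` F n by move=> x [].
rewrite ((nowhereP (F n)).1 (nF n) _ mBF BFn)//.
apply: (hyperfiniteS mBF _ _ _ hB).
- exact: (borel_equivalence_restr ecoding Gsym fmoves).
- by move=> x [].
- move=> [x y] [xy [/= [Bx _] [By _]]]; split=> //.
  by apply: induced_relS xy => z Fz; exists n.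
Qed.

Lemma nowhereU A B : measurable A -> measurable B -> nowhere A -> nowhere B ->
  nowhere (A `|` B).
Proof.
move=> mA mB nA nB; rewrite -bigcup2E; apply: nowhere_bigcup => -[|[|n]] //=.
exact/nowhere_null/mass0.
Qed.

Lemma nowhere_saturated A A' : measurable A' -> A' `<=` A -> saturated G A A' ->
  nowhere A -> nowhere A'.
Proof.
move=> mA' A'A sat /nowhereP nA; apply/nowhereP => B mB BA' hB; apply: nA => //.
  exact: subset_trans A'A.
rewrite (_ : restr _ B = restr (induced_rel G A') B)//.
apply/seteqP; split=> [[x y] [xy [Bx By]]|[x y] [xy ?]]; split=> //.
  by apply: saturated_induced sat xy _; exact: BA'.
exact: induced_relS xy.
Qed.

Hypothesis pmpG : invariant_measure mu (induced_rel G setT).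

Lemma mass_bij A B (h : X -> X) : measurable A -> measurable B ->
  measurable_fun setT h -> set_bij A B h ->
  (forall x, A x -> induced_rel G setT (x, h x)) -> mass A = mass B.
Proof.
move=> mA mB mh bij hR; rewrite /mass (pmpG mA mB _ bij hR)//.
exact: measurable_funTS.
Qed.

Lemma mass_pinj_image A n D : measurable A -> measurable D -> D `<=` pinj f A n ->
  mass (pinj_image f A n D) = mass D.
Proof.
move=> mA mD Dn; apply/esym; apply: (mass_bij mD _ _ (pinj_bij fmoves Dn)).
- exact: (measurable_pinj_image ecoding fmoves).
- exact: (measurable_word fmoves).
- move=> x /Dn[Ax _]; apply: (@induced_relS _ _ _ A) => //.
  exact: (word_rel fmoves).
Qed.

(** The saturation is covered by the countably many images of the null set
    under partial injections inside the classes, and these preserve the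
    measure. *)
Lemma saturation_null N : measurable N -> mass N = 0 ->
  mass (saturation G setT N) = 0.
Proof.
move=> mN N0.
have mD n : measurable (pinj f setT n `&` [set x | N (word f setT (ndecode n).1 x)]).
  apply: measurableI; first exact: (measurable_pinj ecoding fmoves).
  by apply: measurable_preimage => //; exact: (measurable_word fmoves).
rewrite (_ : saturation _ _ _ = \bigcup_n
    (pinj f setT n `&` [set x | N (word f setT (ndecode n).1 x)])).
  apply: mass_bigcup0 => // n; rewrite -(@mass_pinj_image setT n)//.
  apply: mass_sub0 N0 => //.
    exact: (measurable_pinj_image ecoding fmoves).
  by move=> y [_ [[_ Ny] /= <-]].
apply/seteqP; split=> [x [y Ny /(pinjP Gsym fmoves)[n nx xy]]|x [n _ [_ Nx]]].
  by exists n => //; split=> //=; rewrite xy.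
by exists (word f setT (ndecode n).1 x) => //; exact: (word_rel fmoves).
Qed.

(** An almost finite set is hyperfinite on a conull subset, for the relation
    of the graph induced on that subset.  Removing the saturation of the
    exceptional null set makes this the restriction of the relation of A. *)
Lemma nowhere_almost_finite A B : measurable A -> measurable B -> B `<=` A ->
  saturated G A B -> nowhere A -> almost_finite B -> mass B = 0.
Proof.
move=> mA mB BA sat /nowhereP nA hB.
have [B0 [mB0 B0B B00 hB0]] := almost_finite_hyperfinite ecoding Gsym fmoves mB hB.
have mN : measurable (B `\` B0) by exact: measurableD.
have N0 := saturation_null mN B00.
have mS : measurable (saturation G setT (B `\` B0)).
  exact: (measurable_saturation fmoves).
(* Inside B1, paths of A avoid the exceptional set, so the relation of A is
   that of the graph induced on B0. *)
pose B1 := B `\` saturation G setT (B `\` B0).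
have mB1 : measurable B1 by exact: measurableD.
have B1B0 : B1 `<=` B0.
  move=> x [Bx nx]; apply: contrapT => nB0; apply: nx.
  by apply: sub_saturation.
have satB1 : saturated G A B1.
  move=> x y [Bx nx] Ay Gxy; split; first exact: sat Gxy.
  apply: contra_not nx; apply: (saturation_rel Gsym).
  by apply: induced_rel_edge => //; exact: Gsym.
rewrite (mass_split mu mB mS) -[X in _ + X]/(mass B1).
rewrite (_ : mass (B `&` _) = 0); last by apply: mass_sub0 N0 => //; exact: measurableI.
rewrite add0r; apply: nA => //; first by move=> x [/BA].
apply: (hyperfiniteS mB1 _ B1B0 _ hB0).
  apply: (borel_equivalence_restr ecoding Gsym fmoves) => //.
  by move=> x [/BA].
move=> [x y] [xy [B1x B1y]]; apply: (induced_relS B1B0).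
exact: saturated_induced satB1 xy B1x.
Qed.

(** B is an almost finite union of components of maximal measure.  A
    hyperfinite subset of the rest would, through its saturation, enlarge it. *)
Lemma nowhere_decomposition A : measurable A -> exists B,
  [/\ measurable B, B `<=` A, saturated G A B, almost_finite B & nowhere (A `\` B)].
Proof.
move=> mA.
pose P := [set B | [/\ measurable B, B `<=` A, saturated G A B & almost_finite B]].
have [||||B [mB BA satB hB] Bmax] := @exhaustion P.
- by move=> B [].
- by split=> //; apply: almost_finite0 => //; exact: mass0.
- move=> B C [mB BA satB hB] [mC CA satC hC]; split.
  + exact: measurableU.
  + by rewrite subUset.
  + by move=> x y [Bx|Cx] Ay Gxy; [left; exact: satB Gxy|right; exact: satC Gxy].
  + exact: (almost_finiteU Gsym mB mC BA CA satB).
- move=> F PF ndF; split.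
  + by apply: bigcupT_measurable => n; case: (PF n).
  + by apply: bigcup_sub => n _; case: (PF n).
  + by move=> x y [n _ Fx] Ay Gxy; exists n => //; case: (PF n) => _ _ + _; apply; [exact: Fx| |].
  + by apply: almost_finite_bigcup => // n; case: (PF n).
exists B; split=> //.
have mAB : measurable (A `\` B) by exact: measurableD.
apply/nowhereP => C mC CAB hC.
have hS := hyperfinite_almost_finite mu ecoding Gsym hlf fmoves mAB mC CAB hC.
set S := saturation G (A `\` B) C in hS *.
have mS : measurable S by exact: (measurable_saturation fmoves).
have SAB : S `<=` A `\` B by exact: saturation_sub.
have PS : P S.
  split=> //; first by move=> x /SAB[].
  move=> x y Sx Ay Gxy; apply: (saturated_saturation Gsym Sx _ Gxy).
  by apply: (saturatedC Gsym satB _ Ay Gxy); exact: SAB.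
apply: (mass_sub0 mC mS); first exact: sub_saturation.
rewrite (_ : S = S `\` B); first exact: Bmax.
by apply/seteqP; split=> [x Sx|x []//]; split=> //; case: (SAB _ Sx).
Qed.

End nowhere.

(** * Halving a set uniformly over invariant sets *)

Section halving.
Context {d : measure_display} {X : measurableType d} {R : realType}.
Variables (mu : probability X R).
Variables (e : X -> nat -> bool) (G : set (X * X)) (f : nat -> X -> X).
Hypothesis ecoding : coding e.
Hypothesis Gsym : forall x y, G (x, y) -> G (y, x).
Hypothesis hlf : locally_finite G.
Hypothesis fmoves : moves G f.
Hypothesis pmpG : invariant_measure mu (induced_rel G setT).
Hypothesis nowhereG : nowhere mu G setT.
Implicit Types A B K : set X.
Local Notation mass := (mass mu).

(** On such a set the relation is equality, which is hyperfinite. *)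
Lemma independent_null C : measurable C ->
  (forall x y, C x -> C y -> induced_rel G setT (x, y) -> x = y) -> mass C = 0.
Proof.
move=> mC ind; apply: ((nowhereP mu G setT).1 nowhereG C mC) => //.
have bC : borel_equivalence C (restr (induced_rel G setT) C).
  exact: (borel_equivalence_restr ecoding Gsym fmoves).
split=> //; exists (fun=> restr (induced_rel G setT) C); split.
- by [].
- move=> _ x; apply: (sub_finite_set (B := [set x])); last exact: finite_set1.
  by move=> y [xy [/= Cx Cy]]; rewrite /= (ind _ _ Cx Cy xy).
- by move=> n p.
- by apply/seteqP; split=> [p h|p [_ _]//]; exists 0%N.
Qed.

Lemma saturated_setT V x y : saturated G setT V -> induced_rel G setT (x, y) ->
  V x <-> V y.
Proof.
move=> sat xy; split; first exact: saturated_rel sat xy.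
exact: (saturated_rel sat (induced_rel_sym Gsym xy)).
Qed.

Section matching.
Variables (T : set X) (J : nat -> set X).
Hypothesis mT : measurable T.
Hypothesis mJ : forall i, measurable (J i).
Hypothesis finJ : forall t, T t -> finite_set [set i | J i t].

Let gam n := word f setT (ndecode (ndecode n).1).1.
Let mgam n : measurable_fun setT (gam n). Proof. exact: (measurable_word fmoves). Qed.

Let same_type x y := forall l, J l x <-> J l y.

Let D n := [set x | [/\ T x, pinj f setT (ndecode n).1 x, T (gam n x),
  e x (ndecode n).2 /\ ~ e (gam n x) (ndecode n).2 & same_type x (gam n x)]].

Let mD n : measurable (D n).
Proof.
rewrite (_ : D n = T `&` pinj f setT (ndecode n).1 `&` [set x | T (gam n x)] `&`
  ([set x | e x (ndecode n).2] `&` [set x | (~` [set y | e y (ndecode n).2]) (gam n x)]) `&`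
  [set x | forall l, ((J l `&` [set x | J l (gam n x)]) `|`
                      (~` J l `&` [set x | (~` J l) (gam n x)])) x]).
  have mU := measurable_coord ecoding.
  apply: measurableI; first apply: measurableI; first apply: measurableI;
    first apply: measurableI => //.
  - exact: (measurable_pinj ecoding fmoves).
  - exact: (measurable_preimage (mgam n)).
  - apply: measurableI => //.
    by apply: (measurable_preimage (mgam n)); exact: measurableC.
  apply: measurable_forall => l; apply: measurableU; apply: measurableI => //.
  - exact: (measurable_preimage (mgam n)).
  - exact: measurableC.
  - by apply: (measurable_preimage (mgam n)); exact: measurableC.
apply/seteqP; split=> [x [? ? ? [? ?] h]|x [[[[? ?] ?] [? ?]] h]].
  split; first by split; [split; [split|]|split].
  move=> l; have [Jl|nJ] := pselect (J l x).
    by left; split=> //; apply/h.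
  by right; split=> //= /h.
split=> // l; case: (h l) => -[? ?]; split => //.
Qed.

Let fresh n M := D n `&` ~` M `&` [set x | (~` M) (gam n x)].
Let image n M := pinj_image f setT (ndecode n).1 (fresh n M).
Let M := fix M n := if n is n'.+1 then M n' `|` fresh n' (M n') `|` image n' (M n')
                    else set0.
Let D' n := fresh n (M n).
Let I' n := image n (M n).

Let mM n : measurable (M n).
Proof.
elim: n => [|n ih]; first exact: measurable0.
have mfresh : measurable (fresh n (M n)).
  apply: measurableI; first by apply: measurableI => //; exact: measurableC.
  by apply: (measurable_preimage (mgam n)); exact: measurableC.
apply: measurableU; first exact: measurableU.
exact: (measurable_pinj_image ecoding fmoves).
Qed.

Let mD' n : measurable (D' n).
Proof.
apply: measurableI; first by apply: measurableI => //; exact: measurableC.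
by apply: (measurable_preimage (mgam n)); exact: measurableC.
Qed.

Let mI' n : measurable (I' n).
Proof. exact: (measurable_pinj_image ecoding fmoves _ measurableT (mD' n)). Qed.

Let M_le m n : (m <= n)%N -> M m `<=` M n.
Proof.
move=> mn; rewrite -(subnK mn); elim: (n - m)%N => // k ih.
by rewrite addSn => x /ih Mx; left; left.
Qed.

Let I'P n y : I' n y -> exists2 x, D' n x & gam n x = y.
Proof. by move=> [_ [Dx yy]]; exists (word f setT (ndecode (ndecode n).1).2 y). Qed.

Let D'M n : D' n `<=` M n.+1. Proof. by move=> x; left; right. Qed.
Let I'M n : I' n `<=` M n.+1. Proof. by move=> x; right. Qed.
Let D'nM n x : D' n x -> ~ M n x. Proof. by move=> [[_]]. Qed.
Let I'nM n x : I' n x -> ~ M n x. Proof. by move=> /I'P[y [_ /= ?] <-]. Qed.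

Let trivD' : trivIset setT D'.
Proof.
apply: ltn_trivIset => n m mn; rewrite -subset0 => x [Dm Dn].
by apply: (D'nM Dn); apply: (M_le mn); exact: D'M.
Qed.

Let trivI' : trivIset setT I'.
Proof.
apply: ltn_trivIset => n m mn; rewrite -subset0 => x [Dm Dn].
by apply: (I'nM Dn); apply: (M_le mn); exact: I'M.
Qed.

Let D'I' m n x : D' m x -> I' n x -> False.
Proof.
move=> Dm In; have [mn|nm|emn] := ltngtP m n.
- by apply: (I'nM In); apply: (M_le mn); exact: D'M.
- by apply: (D'nM Dm); apply: (M_le nm); exact: I'M.
subst n; have [y [[[_ _ _ [_ ey] _] _] _] yx] := I'P In.
by move: Dm => [[[_ _ _ [ex _] _] _] _]; apply: ey; rewrite yx.
Qed.

Let unmatched_null : mass (T `\` \bigcup_n M n) = 0.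
Proof.
set N := T `\` \bigcup_n M n.
have mN : measurable N by apply: measurableD => //; exact: bigcupT_measurable.
pose tau n : seq nat := odflt [::] (@pickle_inv (seq nat) n).
pose Nt n := N `&` [set x | forall l, J l x <-> l \in tau n].
have mNt n : measurable (Nt n).
  apply: measurableI => //; apply: measurable_forall => l.
  have [lt|lt] := boolP (l \in tau n).
    rewrite (_ : (fun _ => _) = J l)//; apply/funext => x; rewrite propeqE.
    by split; [case=> _; apply|].
  rewrite (_ : (fun _ => _) = ~` J l); first exact: measurableC.
  apply/funext => x; rewrite propeqE; split; first by case=> h _ /h.
  by move=> h; split=> [/h//|].
apply: (mass_sub0 mN (bigcupT_measurable _ mNt)).
  move=> x Nx; have [Tx _] := Nx.
  have /finite_seqP[s sE] := finJ Tx; exists (pickle s) => //; split=> // l.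
  rewrite /tau pickleK_inv /=; split.
    by move=> Jl; have : [set i | J i x] l by []; rewrite sE.
  by move=> ls; have : [set` s] l by []; rewrite -sE.
apply: mass_bigcup0 => // n; apply: independent_null => // x y.
wlog : x y / exists2 k, e x k & ~ e y k.
  move=> hw Nx Ny xy; apply: contrapT => nxy.
  have [k ek] : exists k, e x k <> e y k.
    apply/existsNP => h; apply: nxy; apply: (coding_inj ecoding).
    exact/funext.
  case Ex: (e x k) ek; case Ey: (e y k) => // _.
    by apply: nxy; apply: (hw x y) => //; exists k => //; rewrite Ey.
  apply: nxy; apply/esym; apply: (hw y x) => //; first by exists k => //; rewrite Ex.
  exact: (induced_rel_sym Gsym).
move=> [k exk eyk] [[Tx nMx] tx] [[Ty nMy] ty] xy.
have [q qx qy] := pinjP Gsym fmoves xy.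
exfalso; apply: (nMx); exists (ncode q k).+1 => //; apply: D'M.
have gy : gam (ncode q k) x = y by rewrite /gam ncodeK.
split; last by rewrite /= gy => My; apply: nMy; exists (ncode q k).
split; last by move=> Mx; apply: nMx; exists (ncode q k).
rewrite /D /= gy ncodeK; split=> //= l.
by split=> [/tx /ty|/ty /tx].
Qed.

(** Points of T are matched greedily with points of the same class that
    belong to the same sets [J i].  Types are finite sets, hence countably
    many, and unmatched points of one type are in different classes, hence
    form a null set.  The two sides of the matching then have equal measure
    inside every [J i] and every invariant set. *)
Lemma half_types : exists T', [/\ measurable T', T' `<=` T &
  forall i V, measurable V -> saturated G setT V ->
    mass (T' `&` J i `&` V) = mass ((T `\` T') `&` J i `&` V)].
Proof.
have D'T n : D' n `<=` T by move=> x [[[]]].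
have I'T n : I' n `<=` T by move=> y /I'P[x [[[_ _ Tx _ _] _] _] <-].
have mB : measurable (\bigcup_n D' n) by exact: bigcupT_measurable.
exists (\bigcup_n D' n); split=> //; first by move=> x [n _ /D'T].
move=> i V mV satV.
have mN : measurable (T `\` \bigcup_n M n).
  by apply: measurableD => //; exact: bigcupT_measurable.
have -> : mass ((T `\` \bigcup_n D' n) `&` J i `&` V) =
          mass (\bigcup_n (I' n `&` J i `&` V)).
  have mL : measurable ((T `\` \bigcup_n D' n) `&` J i `&` V).
    by do 2 apply: measurableI => //; exact: measurableD.
  have mU : measurable (\bigcup_n (I' n `&` J i `&` V)).
    by apply: bigcupT_measurable => n; do 2 apply: measurableI => //.
  apply/eqP; rewrite eq_le; apply/andP; split.
    rewrite -[leRHS]addr0 -unmatched_null; apply: le_massU => //.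
    move=> x [[[Tx nD] Jx] Vx]; have [[n _ Mx]|nM] := pselect ((\bigcup_n M n) x); last by right.
    left; elim: n Mx => // n ih [[/ih//|Dx]|Ix]; last by exists n.
    by exfalso; apply: nD; exists n.
  apply: le_mass => // x [n _ [[Ix Jx] Vx]]; do 2 split=> //.
  split; first exact: I'T Ix.
  by move=> [m _ Dm]; exact: D'I' Dm Ix.
have -> : (\bigcup_n D' n) `&` J i `&` V = \bigcup_n (D' n `&` J i `&` V).
  by rewrite !setI_bigcupl.
apply: mass_bigcup_eq.
- by move=> n; do 2 apply: measurableI => //.
- by move=> n; do 2 apply: measurableI => //.
- by do 2 apply: trivIset_setIr.
- by do 2 apply: trivIset_setIr.
move=> n; rewrite -(@mass_pinj_image _ _ _ mu e G f ecoding fmoves pmpG setT (ndecode n).1).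
- congr mass; apply/seteqP; split=> y.
    move=> [_ [[[Dx Jx] Vx] /= yx]]; set x := word _ _ _ y in Dx Jx Vx yx.
    have [[[_ _ _ _ st] _] _] := Dx.
    split; [split|].
    + by split => //; split.
    + by rewrite -yx; apply/st.
    + rewrite -yx; apply/(saturated_setT satV (word_rel fmoves _ (x := x) I)).
      exact: Vx.
  move=> [[[_ [Dx /= yx]] Jy] Vy]; set x := word _ _ _ y in Dx yx.
  have [[[_ _ _ _ st] _] _] := Dx.
  split=> //; split=> //; split; [split=> //|].
    by apply/st; rewrite /gam yx.
  apply/(saturated_setT satV (word_rel fmoves (ndecode (ndecode n).1).1 (x := x) I)).
  by rewrite yx.
- exact: measurableT.
- by do 2 apply: measurableI => //.
- by move=> x [[[[[]]]]].
Qed.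

End matching.
End halving.

(** * Splitting a graph with finite components *)

Lemma finite_minimal (X : Type) (lt : X -> X -> Prop) (F : set X) :
  (forall x, ~ lt x x) -> (forall x y z, lt x y -> lt y z -> lt x z) ->
  finite_set F -> F !=set0 -> exists2 t, F t & forall y, F y -> ~ lt y t.
Proof.
move=> irr trans; elim/Pchoice: X => X in lt F irr trans *.
move=> /finite_seqP[s ->]; elim: s => [[x//]|x s ih _].
have [->|s0] := eqVneq s [::].
  exists x; first by rewrite /= mem_head.
  by move=> y; rewrite /= inE => /eqP ->; exact: irr.
have [|t ts tmin] := ih.
  by case: (s) s0 => // y s' _; exists y; rewrite /= mem_head.
have [xt|nxt] := pselect (lt x t).
  exists x; first by rewrite /= mem_head.
  move=> y; rewrite /= inE => /predU1P[->|ys]; first exact: irr.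
  by move=> yx; apply: (tmin y) => //; exact: trans xt.
exists t; first by rewrite /= inE ts orbT.
by move=> y; rewrite /= inE => /predU1P[->//|ys]; exact: tmin.
Qed.

Section lex.
Context {d : measure_display} {X : measurableType d}.
Variable e : X -> nat -> bool.
Hypothesis ecoding : coding e.

(** The lexicographic order on codes, a Borel linear order that serves to
    choose a point in each finite component. *)
Definition lex (x y : X) := exists n, [/\ e x n = false, e y n = true &
  forall m, (m < n)%N -> e x m = e y m].

Lemma lex_irr x : ~ lex x x.
Proof. by move=> [n [->]]. Qed.

Lemma lex_trans x y z : lex x y -> lex y z -> lex x z.
Proof.
move=> [n [xn yn xy]] [m [ym zm yz]]; have [nm|mn|emn] := ltngtP n m.
- exists n; split=> //; first by rewrite -yz.
  by move=> k kn; rewrite xy// yz//; exact: ltn_trans nm.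
- exists m; split=> //; first by rewrite xy.
  by move=> k km; rewrite xy ?yz//; exact: ltn_trans mn.
- by move: yn; rewrite emn ym.
Qed.

Lemma lex_total x y : ~ lex x y -> ~ lex y x -> x = y.
Proof.
move=> nxy nyx; apply: contrapT => xy.
have /first_index[n exy nmin] : exists n, e x n <> e y n.
  apply/existsNP => h; apply: xy; apply: (coding_inj ecoding); exact/funext.
have h m : (m < n)%N -> e x m = e y m by move=> /nmin/contrapT.
case Ex: (e x n) exy; case Ey: (e y n) => // _.
- by apply: nyx; exists n; split=> // m /h.
- by apply: nxy; exists n; split=> // m /h.
Qed.

Lemma measurable_lex (h1 h2 : X -> X) : measurable_fun setT h1 ->
  measurable_fun setT h2 -> measurable [set x | lex (h1 x) (h2 x)].
Proof.
move=> m1 m2; have mU n b (h : X -> X) : measurable_fun setT h ->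
    measurable [set x | e (h x) n = b].
  move=> mh; have := measurable_preimage mh (measurable_coord ecoding n).
  case: b => // /measurableC; congr measurable.
  by apply/seteqP; split=> x /=; case: (e (h x) n).
rewrite (_ : mkset _ = [set x | exists n,
   ([set x | e (h1 x) n = false] `&` [set x | e (h2 x) n = true] `&`
   [set x | forall m, (m < n)%N -> forall b : bool, e (h1 x) m = b -> e (h2 x) m = b]) x]).
  apply: measurable_exists => n; apply: measurableI; first by apply: measurableI; exact: mU.
  apply: measurable_forall => m; apply: measurable_imply; first exact: measurable_prop.
  by apply: measurable_forall => b; apply: measurable_imply; exact: mU.
apply/seteqP; split=> x [n].
  by move=> [? ? h]; exists n; split=> // m mn b <-; rewrite h.
by move=> [[? ?] h]; exists n; split=> // m mn; rewrite (h m mn _ erefl).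
Qed.

End lex.

Section components.
Context {d : measure_display} {X : measurableType d} {R : realType}.
Variables (mu : probability X R).
Variables (e : X -> nat -> bool) (G : set (X * X)) (f : nat -> X -> X).
Hypothesis ecoding : coding e.
Hypothesis Gsym : forall x y, G (x, y) -> G (y, x).
Hypothesis hlf : locally_finite G.
Hypothesis fmoves : moves G f.
Hypothesis pmpG : invariant_measure mu (induced_rel G setT).
Hypothesis nowhereG : nowhere mu G setT.
Implicit Types A B K : set X.
Local Notation mass := (mass mu).

(** Halving the set T of least points of the components halves K only if
    components of equal size are matched.  The type of a least point t is the
    set of indices i for which the i-th word is the first one to reach its
    value from t: these indices enumerate the component without repetition,
    so that K is the disjoint union over i of copies of the [J i]. *)
Lemma half_components K : measurable K -> fincomp G K ->
  exists Q, [/\ measurable Q, Q `<=` K, saturated G K Q &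
    forall V, measurable V -> saturated G setT V ->
      mass (Q `&` V) = mass ((K `\` Q) `&` V)].
Proof.
move=> mK fK; pose w := word f K.
have mw i : measurable_fun setT (w i) by exact: (measurable_word fmoves).
have wE i x : K x -> induced_rel G K (x, w i x) by exact: (word_rel fmoves).
pose T := K `&` [set x | forall i, ~ lex e (w i x) x].
have mT : measurable T.
  apply: measurableI => //; apply: measurable_forall => i.
  by apply: measurableC; apply: (measurable_lex ecoding) => //.
have Tex x : K x -> exists2 t, T t & induced_rel G K (x, t).
  move=> Kx; have [||||t xt tmin] := @finite_minimal _ (lex e) [set y | induced_rel G K (x, y)].
  - exact: lex_irr.
  - exact: lex_trans.
  - exact: fK.
  - by exists x; exact: induced_rel_refl.
  exists t => //; have [_ Kt] := induced_rel_sub xt; split=> // i.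
  by apply: tmin; apply: induced_rel_trans xt _; exact: wE.
have Tuniq t t' : T t -> T t' -> induced_rel G K (t, t') -> t = t'.
  move=> [Kt tmin] [Kt' tmin'] tt'; apply: (lex_total ecoding).
    have /(induced_relP fmoves)[_ [i <-]] := induced_rel_sym Gsym tt'.
    exact: tmin'.
  by have /(induced_relP fmoves)[_ [i <-]] := tt'; exact: tmin.
have mP i : measurable (K `&` [set x | T (w i x)]).
  by apply: measurableI => //; exact: measurable_preimage.
have [s ms hs] := measurable_first_select mP mw.
have sT x : K x -> T (s x) /\ induced_rel G K (x, s x).
  move=> Kx; have [t Tt xt] := Tex _ Kx.
  have [|i [_ Pi] imin] := @first_index (fun i => (K `&` [set x | T (w i x)]) x).
    by have /(induced_relP fmoves)[_ [i ix]] := xt; exists i; split; rewrite //= /w ix.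
  by rewrite ((hs x).1 i) => //; split; [exact: Pi|exact: wE].
have sE x y : induced_rel G K (x, y) -> s x = s y.
  move=> xy; have [Kx Ky] := induced_rel_sub xy.
  have [Tx xs] := sT _ Kx; have [Ty ys] := sT _ Ky; apply: Tuniq => //.
  apply: induced_rel_trans (induced_rel_sym Gsym xs) _.
  exact: induced_rel_trans ys.
have sTid t : T t -> s t = t.
  by move=> Tt; have [Kt _] := Tt; have [Ts ts] := sT _ Kt; apply/esym; exact: Tuniq.
pose J i := T `&` [set t | forall k, (k < i)%N -> (~` [set t | w k t = w i t]) t].
have mJ i : measurable (J i).
  apply: measurableI => //; apply: measurable_forall => k.
  apply: measurable_imply; first exact: measurable_prop.
  by apply: measurableC; exact: (measurable_eq_fun ecoding).
(* C i is the set of points of K that the i-th word reaches first from the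
   least point of their component. *)
pose C i := K `&` [set x | w i (s x) = x] `&`
  [set x | forall k, (k < i)%N -> (~` [set x | w k (s x) = x]) x].
have mws i : measurable [set x | w i (s x) = x].
  apply: (measurable_eq_fun ecoding); last exact: measurable_id.
  exact: (measurableT_comp (mw i) ms).
have mC i : measurable (C i).
  apply: measurableI; first exact: measurableI.
  apply: measurable_forall => k; apply: measurable_imply; first exact: measurable_prop.
  exact: measurableC.
have finJ t : T t -> finite_set [set i | J i t].
  move=> Tt; have [Kt _] := Tt.
  have inj : {in [set i | J i t] &, injective (fun i => w i t)}.
    move=> i j /set_mem[_ hi] /set_mem[_ hj] wij.
    by have [ij|ji|//] := ltngtP i j; [case: (hj i ij)|case: (hi j ji)].
  rewrite -(eq_finite_set (inj_card_eq inj)).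
  by apply: (sub_finite_set _ (fK _ Kt)) => _ [i _ <-] /=; exact: wE.
(* The i-th word maps the copy J i of the least points onto C i, inside the
   classes. *)
have transport W i V : measurable W -> measurable V -> saturated G setT V ->
    mass (W `&` J i `&` V) = mass (C i `&` (s @^-1` W) `&` V).
  move=> mW mV satV; have ws t : J i t -> s (w i t) = t.
    move=> [Tt _]; rewrite -[RHS]sTid//; apply/esym/sE; apply: wE.
    by case: Tt.
  apply: (mass_bij pmpG (h := w i)) => //.
  - by do 2 apply: measurableI => //.
  - do 2 apply: measurableI => //; exact: (measurable_preimage ms).
  - split.
    + move=> t [[Wt Jt] Vt]; have wst := ws _ Jt; have [Tt kt] := Jt.
      have [Kt _] := Tt; have tw := wE i _ Kt; have [_ Kw] := induced_rel_sub tw.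
      split; first split.
      * split; first by split=> //=; rewrite wst.
        by move=> k ki /=; rewrite wst; exact: kt.
      * by rewrite /preimage /= wst.
      * by apply: (saturated_rel satV _ Vt); apply: induced_relS tw.
    + move=> t t' /set_mem[[_ Jt] _] /set_mem[[_ Jt'] _] tt'.
      by rewrite -(ws _ Jt) -(ws _ Jt') tt'.
    + move=> x [[[[Kx /= wx] kx] Wx] Vx]; exists (s x) => //.
      have [Tsx xsx] := sT _ Kx; split; first split=> //.
        by split=> // k /kx /=; rewrite wx.
      by apply: (saturated_rel satV _ Vx); apply: induced_relS xsx.
  - move=> t [[_ [[Kt _] _]] _].
    by apply: (@induced_relS _ _ _ K) => //; exact: wE.
have [T' [mT' T'T halfT']] :=
  half_types ecoding Gsym fmoves pmpG nowhereG mT mJ finJ.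
have CK W V : K `&` s @^-1` W `&` V = \bigcup_i (C i `&` s @^-1` W `&` V).
  apply/seteqP; split=> [x [[Kx Wx] Vx]|x [i _ [[[[Kx _] _] Wx] Vx]]//].
  have [_ xs] := sT _ Kx.
  have [|i wi imin] := @first_index (fun i => w i (s x) = x).
    by have /(induced_relP fmoves)[_] := induced_rel_sym Gsym xs.
  by exists i.
have trivC : trivIset setT C.
  apply: ltn_trivIset => j i ij; rewrite -subset0 => x [[[_ /= wi] _] [_ hj]].
  exact: (hj _ ij).
exists (K `&` s @^-1` T'); split.
- by apply: measurableI => //; exact: (measurable_preimage ms).
- by move=> x [].
- move=> x y [Kx Tx] Ky Gxy; split=> //; rewrite /preimage /= -(sE x y) //.
  exact: induced_rel_edge.
- move=> V mV satV.
  have -> : K `\` (K `&` s @^-1` T') = K `&` s @^-1` (T `\` T').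
    apply/seteqP; split=> [x [Kx nT]|x [Kx [_ nT]]].
      by split=> //; split; [case: (sT _ Kx)|move=> ?; apply: nT].
    by split=> // -[].
  rewrite !CK; apply: mass_bigcup_eq => [i|i|||i].
  + do 2 apply: measurableI => //; exact: (measurable_preimage ms).
  + do 2 apply: measurableI => //; apply: (measurable_preimage ms).
    exact: measurableD.
  + by do 2 apply: trivIset_setIr.
  + by do 2 apply: trivIset_setIr.
  + by rewrite -!transport//; [exact: halfT'|exact: measurableD].
Qed.

(** Repeated halving.  The pieces are the fibres of a colouring, which keeps
    them disjoint. *)
Lemma split_components K n : measurable K -> fincomp G K ->
  exists c : X -> nat, [/\ forall i, measurable [set x | c x = i],
    forall x y, K x -> K y -> G (x, y) -> c x = c y,
    forall x, (c x < 2 ^ n)%N &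
    forall i V, (i < 2 ^ n)%N -> measurable V -> saturated G setT V ->
      (2 ^ n)%:R * mass (K `&` [set x | c x = i] `&` V) = mass (K `&` V)].
Proof.
move=> mK fK; elim: n => [|n [c [mc cE clt cmass]]].
  exists (fun=> 0%N); split=> //.
    by move=> i; exact: measurable_prop.
  move=> i V; rewrite ltnS leqn0 => /eqP -> mV satV; rewrite expn0 mul1r.
  by congr mass; apply/seteqP; split=> x; [case=> -[]|case].
have /choice[Q hQ] i : exists Q, let Ki := K `&` [set x | c x = i] in
   [/\ measurable Q, Q `<=` Ki, saturated G Ki Q &
    forall V, measurable V -> saturated G setT V ->
      mass (Q `&` V) = mass ((Ki `\` Q) `&` V)].
  apply: half_components; first exact: measurableI.
  by apply: fincompS fK => x [].
exists (fun x => ((c x).*2 + `[< Q (c x) x >])%N).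
have cE' x i : ((c x).*2 + `[< Q (c x) x >])%N = i <->
    c x = i./2 /\ (Q i./2 x <-> odd i).
  split=> [<-|[-> Qi]].
    rewrite halfD half_double odd_double add0n oddD odd_double addFb oddb /=.
    rewrite (_ : (nat_of_bool _)./2 = 0%N) ?addn0; last by case: asboolP.
    by split=> //; split=> [?|/asboolP//]; exact/asboolP.
  rewrite addnC -[RHS]odd_double_half; congr (_ + _)%N.
  by congr nat_of_bool; apply/asboolP/idP => /Qi.
split.
- move=> i; rewrite (_ : mkset _ = [set x | c x = i./2] `&`
    (if odd i then Q i./2 else ~` Q i./2)).
    by apply: measurableI => //; case: (hQ i./2) => mQ _ _ _; case: ifP => _ //; exact: measurableC.
  apply/seteqP; split=> x.
    by move=> /cE'[? [h1 h2]]; split=> //; case: ifP => [//|oi /h1]; rewrite oi.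
  by move=> [? h]; apply/cE'; split=> //; move: h; case: ifP => oi h; split.
- move=> x y Kx Ky Gxy; have cxy := cE _ _ Kx Ky Gxy; rewrite -cxy; congr (_ + _)%N.
  congr nat_of_bool; have [_ _ satQ _] := hQ (c x).
  apply/asboolP/asboolP => h.
    by apply: satQ h _ Gxy; split.
  by apply: satQ h _ (Gsym Gxy); split.
- move=> x; have := clt x; rewrite -leq_double doubleS expnS mul2n.
  by apply: leq_trans; case: `[< _ >]; rewrite ?addn1 ?addn0.
- move=> i V; rewrite expnS => iltn mV satV.
  have i2 : (i./2 < 2 ^ n)%N by rewrite ltn_half_double -mul2n.
  have [mQ QK _ halfQ] := hQ i./2.
  set Ki := K `&` [set x | c x = i./2] in QK halfQ.
  have mKi : measurable Ki by exact: measurableI.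
  have KiV : mass (Ki `&` V) = mass (Q i./2 `&` V) + mass ((Ki `\` Q i./2) `&` V).
    rewrite (mass_split mu (measurableI _ _ mKi mV) mQ); congr (mass _ + mass _).
      by apply/seteqP; split=> x; [case=> -[]|case=> /[dup] /QK].
    by apply/seteqP; split=> x; [case=> -[? ?] ?|case=> -[? ?] ?].
  rewrite natrM mulrAC -(cmass i./2 V i2 mV satV) -/Ki KiV -(halfQ V mV satV).
  rewrite (_ : mass _ = mass (Q i./2 `&` V)); first by rewrite mulrC; lra.
  case oi: (odd i); [|rewrite (halfQ V mV satV)]; congr mass; apply/seteqP.
    split=> x.
      by move=> [[Kx /cE'[_ [_ /(_ oi)]]] Vx].
    move=> [Qx Vx]; have [Kx cx] := QK _ Qx; split=> //; split=> //.
    by apply/cE'.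
  split=> x.
    move=> [[Kx /cE'[cx [h _]]] Vx]; split=> //; split=> // Qx.
    by have := h Qx; rewrite oi.
  move=> [[[Kx cx] nQ] Vx]; split=> //; split=> //; apply/cE'; split=> //.
  by split=> // h; have := h; rewrite oi.
Qed.

End components.

(** * Sections of small measure in bounded degree *)

Lemma near_optimal (R : realType) (T : Type) (P : set T) (v : T -> R) (b eta : R) :
  0 < eta -> P !=set0 -> (forall t, P t -> v t <= b) ->
  exists2 t, P t & forall u, P u -> v u <= v t + eta.
Proof.
move=> eta0 [t0 Pt0] vb; pose S := [set v t | t in P].
have supS : has_sup S.
  by split; [exists (v t0), t0|exists b => _ [t Pt <-]; exact: vb].
have [_ [t Pt <-] lt] := sup_adherent eta0 supS.
exists t => // u Pu; rewrite -lerBlDr; apply: ltW; apply: le_lt_trans lt.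
by rewrite lerB// sup_upper_bound//; exists u.
Qed.

Section small_section.
Context {d : measure_display} {X : measurableType d} {R : realType}.
Variables (mu : probability X R).
Variables (e : X -> nat -> bool) (G : set (X * X)) (f : nat -> X -> X).
Hypothesis ecoding : coding e.
Hypothesis Gsym : forall x y, G (x, y) -> G (y, x).
Hypothesis hlf : locally_finite G.
Hypothesis fmoves : moves G f.
Hypothesis pmpG : invariant_measure mu (induced_rel G setT).
Hypothesis nowhereG : nowhere mu G setT.
Implicit Types A B K U V W : set X.
Local Notation mass := (mass mu).
Local Notation almost_finite := (almost_finite mu G).
Local Notation nowhere := (nowhere mu G).
Local Notation sat := (saturation G setT).

Lemma mass_fibers (N : nat) (H : set X) (g : X -> nat) : measurable H ->
  (forall i, measurable [set x | g x = i]) ->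
  \sum_(i < N) mass (H `&` [set x | g x = i]) <= mass H.
Proof.
move=> mH mg.
have mlt n : measurable [set x | (g x < n)%N].
  rewrite (_ : mkset _ = [set x | exists i : 'I_n, g x = i]).
    by apply: (measurable_exists (F := fun i : 'I_n => [set x | g x = i])).
  apply/seteqP; split=> [x gx|x [i gx]]; last by rewrite /= gx.
  by exists (Ordinal gx).
suff -> : \sum_(i < N) mass (H `&` [set x | g x = i]) = mass (H `&` [set x | (g x < N)%N]).
  by apply: le_mass => [||x []//] //; exact: measurableI.
elim: N => [|N ih].
  by rewrite big_ord0 (_ : _ `&` _ = set0) ?mass0// -subset0 => x [].
rewrite big_ord_recr /= ih -massU.
- congr mass; rewrite -setIUr; congr (_ `&` _); apply/seteqP; split=> x.
    by case=> /= [/leqW//|->].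
  by rewrite /= ltnS leq_eqVlt => /predU1P[?|?]; [right|left].
- exact: measurableI.
- exact: measurableI.
- by rewrite -subset0 => x [[_ /= gx] [_ /= gN]]; move: gx; rewrite gN ltnn.
Qed.

Lemma mass_union_le (N : nat) (F : nat -> set X) : (forall i, measurable (F i)) ->
  mass [set x | exists i : 'I_N, F i x] <= \sum_(i < N) mass (F i).
Proof.
move=> mF; elim: N => [|N ih].
  by rewrite big_ord0 (_ : mkset _ = set0) ?mass0// -subset0 => x [[]].
rewrite big_ord_recr /=; apply: le_trans (lerD ih (lexx _)).
apply: le_massU => //; do ?exact: measurable_exists.
move=> x [i Fi]; have [iN|] := ltnP i N; first by left; exists (Ordinal iN).
move=> Ni; right; rewrite (_ : N = i :> nat)//.
by apply/eqP; rewrite eqn_leq Ni -ltnS ltn_ord.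
Qed.

(** The limsup of the invariant sets U is invariant, has measure at least q
    inside A, and A is almost finite there: outside the union of the
    exceptional sets, whose measures are summable, each component lies in one
    of the sets U and in its K. *)
Lemma fincomp_limsup A (q : R) : measurable A -> nowhere A ->
  (forall eta : R, 0 < eta -> exists U K, [/\ measurable U /\ saturated G setT U,
     measurable K /\ K `<=` A `&` U, fincomp G K, q <= mass (A `&` U) &
     mass ((A `&` U) `\` K) <= eta]) -> q <= 0.
Proof.
move=> mA nA h.
have pow0 n : 0 < ((2 ^ n)%:R^-1 : R) by rewrite invr_gt0 ltr0n expn_gt0.
have /choice[U /choice[K hUK]] n := h _ (pow0 n.+1).
have mU n : measurable (U n) by case: (hUK n) => -[].
have mK n : measurable (K n) by case: (hUK n) => _ [].
pose V := \bigcap_n \bigcup_i U (n + i)%N.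
have mV : measurable V by apply: bigcapT_measurable => n; exact: bigcupT_measurable.
have satV : saturated G setT V.
  move=> x y Vx _ Gxy n _; have [i _ Ui] := Vx n I; exists i => //.
  by have [[_ satU] _ _ _ _] := hUK (n + i)%N; exact: satU Gxy.
have mAV : measurable (A `&` V) by exact: measurableI.
have mAU n : measurable (A `&` U n) by exact: measurableI.
apply: (@le_trans _ _ (mass (A `&` V))).
  have qAU n : q <= mass (A `&` U n) by case: (hUK n).
  apply: le_trans (mass_limsup mAU qAU) _.
  apply: le_mass => //.
    by apply: bigcapT_measurable => n; apply: bigcupT_measurable.
  move=> x hx; split; first by have [i _ []] := hx 0%N I.
  by move=> n _; have [i _ [_ Ui]] := hx n I; exists i.
suff -> : mass (A `&` V) = 0 by [].
apply: (nowhere_almost_finite ecoding Gsym fmoves pmpG mA) => //.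
  by move=> x y [Ax Vx] Ay Gxy; split=> //; exact: satV Gxy.
move=> eps eps0; have [n _ /(_ n (leqnn n)) /= hn] := near_infty_natSinv_expn_lt (PosNum eps0).
pose bad := \bigcup_i ((A `&` U (n + i)%N) `\` K (n + i)%N).
have mbad : measurable bad by apply: bigcupT_measurable => i; exact: measurableD.
exists ((A `&` V) `\` bad); split.
- exact: measurableD.
- by move=> x [].
- apply: fincomp_local => x [[Ax Vx] nbad]; have [i _ Ui] := Vx n I.
  have [[_ satU] _ fK _ _] := hUK (n + i)%N.
  exists (((A `&` V) `\` bad) `&` U (n + i)%N); split.
  + by move=> u v [_ Uu] Lv Guv; split=> //; exact: satU Guv.
  + by split.
  + apply: fincompS fK => u [[[Au Vu] nbu] Uu]; apply: contrapT => nK; apply: nbu.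
    by exists i.
- apply: le_lt_trans hn; rewrite div1r -natrX.
  apply: (@le_trans _ _ (mass bad)).
    apply: le_mass => //; first by do 2 apply: measurableD => //.
    by move=> x [AVx nL]; apply: contrapT => nb; apply: nL.
  apply: mass_bigcup_le => [i||i]; [exact: measurableD|exact: ltW|].
  have [_ _ _ _ le] := hUK (n + i)%N; apply: le_trans le _.
  by rewrite -addnS expnD natrM invfM.
Qed.

Section competitor.
Variables (A0 : set X) (D : nat).
Hypothesis mA0 : measurable A0.
Hypothesis degA0 : forall x y, A0 x -> A0 y -> G (x, y) ->
  exists2 j, (j < D)%N & f j x = y.

(** Competition for small measure takes place among sets with the same
    saturation as A0 up to null sets; without this condition one could shrink
    a set by keeping few classes. *)
Definition competitor A := [/\ measurable A, A `<=` A0, nowhere A &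
  mass (A0 `\` sat A) = 0].

Variables (A : set X) (delta : R).
Hypothesis delta0 : 0 < delta.
Hypothesis compA : competitor A.
Hypothesis minA : forall B, competitor B -> mass A <= mass B + delta.

Let mA : measurable A. Proof. by case: compA. Qed.

Lemma msat B : measurable B -> measurable (sat B).
Proof. by move=> mB; exact: (measurable_saturation fmoves). Qed.

(** Split A minus P into an almost finite part and a nowhere hyperfinite
    part, and let W be the saturation of the latter.  Replacing A by that
    part inside W gives a competitor, which loses all of P inside W; so P is
    small there. *)
Lemma removable P : measurable P -> P `<=` A ->
  exists W, [/\ measurable W, saturated G setT W, mass (P `&` W) <= delta &
    almost_finite ((A `\` P) `\` W)].
Proof.
move=> mP PA; have [_ AA0 nA satA] := compA.
have mAP : measurable (A `\` P) by exact: measurableD.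
have [B [mB BAP satB hB nB]] := nowhere_decomposition mu ecoding Gsym hlf fmoves mAP.
set A2 := (A `\` P) `\` B in nB.
have mA2 : measurable A2 by exact: measurableD.
have mW := msat mA2; have satW := saturated_saturation Gsym (A := setT) (B := A2).
have A2W : A2 `<=` sat A2 by exact: sub_saturation.
exists (sat A2); split=> //; last first.
  apply: (almost_finiteS mB _ _ hB); first exact: measurableD.
  by move=> x [APx nW]; apply: contrapT => nBx; apply: nW; exact: A2W.
have mAW : measurable (A `\` sat A2) by exact: measurableD.
have mPW : measurable (P `&` sat A2) by exact: measurableI.
have compB : competitor (A2 `|` (A `\` sat A2)).
  split; first exact: measurableU.
  - by move=> x [[[/AA0]]|[/AA0]].
  - apply: (nowhereU ecoding Gsym fmoves) => //.
    have sAW : A `\` sat A2 `<=` A by move=> x [].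
    apply: (nowhere_saturated mAW sAW _ nA).
    move=> x y [Ax nx] Ay Gxy; split=> // Wy; apply: nx; apply: satW Wy _ _ => //.
    exact: Gsym.
  - have mAA : measurable (A0 `\` sat A) by apply: measurableD => //; exact: msat.
    apply: (mass_sub0 _ mAA _ satA).
      by apply: measurableD => //; apply: msat; exact: measurableU.
    move=> x [A0x nx]; split=> // -[y Ay xy]; apply: nx.
    have [[z A2z yz]|nWy] := pselect (sat A2 y).
      by exists z; [left|exact: induced_rel_trans yz].
    by exists y => //; right.
have le1 := minA compB.
have : mass (A2 `|` (A `\` sat A2)) + mass (P `&` sat A2) <= mass A.
  rewrite -massU//; last 2 first.
  - exact: measurableU.
  - by rewrite -subset0 => x [[[[_ nP] _]|[_ nW]] [Px Wx]].
  apply: le_mass => //; first by apply: measurableU => //; exact: measurableU.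
  by move=> x [[[[Ax _] _]|[Ax _]]|[Px _]] //; exact: PA.
by move: le1; lra.
Qed.

(** Remove one half Q of A.  The half that remains is almost finite outside
    W, while inside W both halves are small. *)
Lemma large_fincomp : exists K, [/\ measurable K, K `<=` A, fincomp G K &
  mass A / 2 - 2 * delta <= mass K].
Proof.
pose J i := if i is 0%N then setT else (set0 : set X).
have [||Q [mQ QA halfQ]] := half_types ecoding Gsym fmoves pmpG nowhereG mA (J := J).
- by move=> [|i]; [exact: measurableT|exact: measurable0].
- by move=> t _; apply: (sub_finite_set _ (finite_set1 0%N)) => -[].
have [W [mW satW le hW]] := removable mQ QA.
have [K [mK KAQ fK ltK]] := hW _ delta0.
exists K; split=> //; first by move=> x /KAQ[[]].
have halfT : mass Q = mass (A `\` Q).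
  by have := halfQ 0%N setT measurableT (fun _ _ _ _ _ => I); rewrite /= !setIT.
have halfW : mass (Q `&` W) = mass ((A `\` Q) `&` W).
  by have := halfQ 0%N W mW satW; rewrite /= !setIT.
have mAQ : measurable (A `\` Q) by exact: measurableD.
have := mass_split mu mA mQ; rewrite (_ : A `&` Q = Q); last first.
  by apply/seteqP; split=> [x []//|x Qx]; split=> //; exact: QA.
have := mass_split mu mAQ mW.
have := mass_split mu (measurableD mAQ mW) mK.
rewrite (_ : ((A `\` Q) `\` W) `&` K = K); last first.
  by apply/seteqP; split=> [x []//|x Kx]; split=> //; exact: KAQ.
move: le ltK; rewrite halfW halfT; lra.
Qed.

(* With N = 2 ^ (D + 1) there are at least 2 D pieces. *)
Let n := D.+1.
Let N := (2 ^ n)%N.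

Lemma spread (eta : R) : 0 < eta -> exists U K, [/\ measurable U /\ saturated G setT U,
     measurable K /\ K `<=` A `&` U, fincomp G K,
     mass A / 2 - 2 * delta - eta - (N * N)%:R * delta <= mass (A `&` U) &
     mass ((A `&` U) `\` K) <= 4 * eta].
Proof.
move=> eta0; have [_ AA0 nA satA] := compA.
pose good K := [/\ measurable K, K `<=` A & fincomp G K].
(* K is optimal up to eta among the subsets of A with finite components. *)
have [||K [mK KA fK] Kmax] := @near_optimal _ _ good mass 1 eta eta0.
- by exists set0; split.
- by move=> K [mK _ _]; rewrite -(massT mu); exact: le_mass.
have [c [mc cE clt cmass]] := split_components ecoding Gsym fmoves pmpG nowhereG n mK fK.
pose P i := K `&` [set x | c x = i].
have mP i : measurable (P i) by exact: measurableI.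
have PA i : P i `<=` A by move=> x [/KA].
have /choice[W hW] i := removable (mP i) (@PA i).
have mW i : measurable (W i) by case: (hW i).
pose V := [set x | exists i : 'I_N, W i x].
have mV : measurable V by exact: measurable_exists.
have satV : saturated G setT (~` V).
  move=> x y nV _ Gxy [i Wi]; apply: nV; exists i.
  by have [_ satW _ _] := hW i; apply: satW Wi _ _ => //; exact: Gsym.
set U := ~` V in satV; have mU : measurable U by exact: measurableC.
have massKV : mass (K `&` V) <= (N * N)%:R * delta.
  apply: (@le_trans _ _ (\sum_(i < N) mass (K `&` W i))).
    rewrite (_ : K `&` V = [set x | exists i : 'I_N, (K `&` W i) x]).
      by apply: (@mass_union_le N (fun i => K `&` W i)) => i; exact: measurableI.
    apply/seteqP; split=> [x [Kx [i Wi]]|x [i [Kx Wi]]]; first by exists i.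
    by split=> //; exists i.
  apply: (@le_trans _ _ (\sum_(i < N) N%:R * delta)).
    apply: ler_sum => i _; have [_ satW le _] := hW i.
    rewrite -(cmass i _ (ltn_ord i) (mW i) satW) ler_wpM2l ?ler0n//.
  by rewrite sumr_const card_ord -[leLHS]mulr_natl natrM mulrA.
pose C := A `\` K; have mC : measurable C by exact: measurableD.
(* The vertices outside K that are adjacent to the i-th piece. *)
pose Gam i := C `&` [set x | exists j : 'I_D, P i (f j x)].
have mf : forall j, measurable_fun setT (f j) by case: fmoves.
have mGam i : measurable (Gam i).
  apply: measurableI => //; apply: measurable_exists => j.
  exact: measurable_preimage (mP i).
have mCU : measurable (C `&` U) by exact: measurableI.
(* On U compare K with the piece P i joined to an approximation K' of the
   rest of A, minus the neighbours of P i. *)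
have key i : (i < N)%N -> mass (C `&` U) <= 2 * eta + mass (Gam i `&` U).
  move=> iN; have [_ _ _ /(_ _ eta0)[K' [mK' K'A fK' ltK']]] := hW i.
  have mK'G : measurable (K' `\` Gam i) by exact: measurableD.
  have mPU : measurable (P i `&` U) by exact: measurableI.
  have mKU : measurable (K `\` U) by exact: measurableD.
  have mK'U : measurable (K' `&` U) by exact: measurableI.
  pose L := (P i `&` U) `|` ((K' `&` U) `\` Gam i).
  have mL1 : measurable ((K' `&` U) `\` Gam i) by exact: measurableD.
  have mL : measurable L by exact: measurableU.
  have good2 : good (L `|` (K `\` U)).
    split; first exact: measurableU.
    - by move=> x [[[/PA]|[[/K'A[[]]]]]|[/KA]].
    - apply: (fincompU Gsym); last 1 first.
      + move=> x y Lx [Ky nU] Gxy; apply: nU.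
        by apply: (satV x) Gxy => //; case: Lx => [[]|[[]]].
      + apply: (fincompU Gsym).
        * by apply: fincompS fK => x [[]].
        * by apply: fincompS fK' => x [[]].
        move=> x y [[Kx cx] Ux] [[K'y Uy] nG] Gxy.
        have [[Ay nPy] nWy] := K'A _ K'y.
        have [Ky|nKy] := pselect (K y).
          by apply: nPy; split=> //=; rewrite -(cE _ _ Kx Ky Gxy).
        have [j jD fj] := degA0 (AA0 _ Ay) (AA0 _ (KA _ Kx)) (Gsym Gxy).
        by apply: nG; split=> //; exists (Ordinal jD); rewrite /= fj.
      + by apply: fincompS fK => x [].
  have := Kmax _ good2.
  rewrite massU//; last by rewrite -subset0 => x [[[_ Ux]|[[_ Ux] _]] [_]]; apply.
  rewrite massU//; last first.
    by rewrite -subset0 => x [[Px _] [[/K'A[[_ nP] _] _] _]].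
  have mAPU : measurable ((A `\` P i) `&` U) by apply: measurableI => //; exact: measurableD.
  have le1 : mass ((A `\` P i) `&` U) <=
      mass ((K' `&` U) `\` Gam i) + (mass (((A `\` P i) `\` W i) `\` K') + mass (Gam i `&` U)).
    have mX : measurable (((A `\` P i) `\` W i) `\` K').
      by do 3 apply: measurableD => //.
    have mY : measurable (Gam i `&` U) by exact: measurableI.
    apply: le_trans (lerD (lexx _) (massUle mu mX mY)).
    apply: le_massU => //; first exact: measurableU.
    move=> x [[Ax nP] Ux].
    have nW : ~ W i x by move=> Wx; apply: Ux; exists (Ordinal iN).
    have [Gx|nGx] := pselect (Gam i x); first by right; right.
    have [K'x|nK'x] := pselect (K' x); first by left.
    by right; left.
  have e1 := mass_split mu mK mU.
  have AU : A `&` U = (P i `&` U) `|` ((A `\` P i) `&` U).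
    rewrite -setIUl setDUK//; exact: PA.
  have e2 : mass (A `&` U) = mass (P i `&` U) + mass ((A `\` P i) `&` U).
    by rewrite AU massU// -subset0 => x [[Px _] [[_]]].
  have e3 : mass (A `&` U) = mass (K `&` U) + mass (C `&` U).
    rewrite -massU//.
    - by rewrite -setIUl setDUK.
    - exact: measurableI.
    - by rewrite -subset0 => x [[Kx _] [[_]]].
  move: le1 ltK'; lra.
(* A vertex of A is adjacent to at most D pieces. *)
have sumG : \sum_(i < N) mass (Gam i `&` U) <= D%:R * mass (C `&` U).
  apply: (@le_trans _ _ (\sum_(i < N) \sum_(j < D)
      mass ((C `&` U) `&` [set x | c (f j x) = i]))).
    apply: ler_sum => i _.
    have mX j : measurable ((C `&` U) `&` [set x | c (f j x) = i]).
      by apply: measurableI => //; exact: (measurable_preimage (mf j) (mc i)).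
    apply: le_trans (mass_union_le D mX); apply: le_mass.
    - exact: measurableI.
    - exact: measurable_exists.
    by move=> x [[Cx [j [_ /= cj]]] Ux]; exists j.
  rewrite exchange_big /=.
  apply: (@le_trans _ _ (\sum_(j < D) mass (C `&` U))).
    apply: ler_sum => j _; apply: (@mass_fibers N _ (fun x => c (f j x))) => // i.
    exact: (measurable_preimage (mf j) (mc i)).
  by rewrite sumr_const card_ord mulr_natl.
have massCU : mass (C `&` U) <= 4 * eta.
  have : N%:R * mass (C `&` U) <= N%:R * (2 * eta) + D%:R * mass (C `&` U).
    apply: le_trans (lerD (lexx _) sumG).
    have : \sum_(i < N) mass (C `&` U) <= \sum_(i < N) (2 * eta + mass (Gam i `&` U)).
      by apply: ler_sum => i _; exact: key.
    rewrite big_split /= !sumr_const card_ord.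
    by rewrite -(mulr_natl (mass _)) -(mulr_natl (2 * eta)).
  have N2D : 2 * D%:R <= N%:R :> R.
    by rewrite -natrM ler_nat /N expnS leq_pmul2l// ltnW// ltn_expl.
  have N0 : 0 < N%:R :> R by rewrite ltr0n expn_gt0.
  have := mass_ge0 mu (C `&` U); set t := mass _ => t0 h.
  rewrite -(ler_pM2l N0); nra.
exists U, (K `&` U); split=> //.
- by split; [exact: measurableI|move=> x [/KA ? ?]].
- by apply: fincompS fK => x [].
- have [K2 [mK2 K2A fK2 leK2]] := large_fincomp.
  have le2 : mass K2 <= mass K + eta by apply: Kmax.
  have le3 : mass (K `&` U) <= mass (A `&` U).
    by apply: le_mass; [exact: measurableI|exact: measurableI|move=> x [/KA]].
  have := mass_split mu mK mV; rewrite -[K `\` V]/(K `&` U).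
  move: massKV; lra.
- rewrite (_ : (A `&` U) `\` (K `&` U) = C `&` U)//.
  apply/seteqP; split=> [x [[Ax Ux] nKU]|x [[Ax nK] Ux]].
    by split=> //; split=> // Kx; apply: nKU.
  by split=> // -[].
Qed.

End competitor.

Lemma small_section A0 (D : nat) (eps : R) : measurable A0 ->
  (forall x y, A0 x -> A0 y -> G (x, y) -> exists2 j, (j < D)%N & f j x = y) ->
  nowhere A0 -> 0 < eps ->
  exists A, competitor A0 A /\ mass A < eps.
Proof.
move=> mA0 degA0 nA0 eps0; apply: contrapT => /forallNP h.
have {}h B : competitor A0 B -> eps <= mass B.
  by move=> cB; rewrite leNgt; apply/negP => lt; apply: (h B).
pose N : R := (2 ^ D.+1 * 2 ^ D.+1)%:R.
have N0 : 0 <= N by rewrite ler0n.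
pose delta := eps / (8 * (N + 2)).
(* With this delta the loss in the estimate of the invariant set is at most
   half of the eps / 2 available: eps / 8 for the terms in delta and eps / 8
   for eta. *)
have deltaE : (N + 2) * delta = eps / 8.
  by rewrite /delta; field; lra.
have delta0 : 0 < delta by rewrite divr_gt0//; lra.
have [||A compA minA] := @near_optimal _ _ (competitor A0) (fun A => - mass A) 0 delta delta0.
- exists A0; split=> //; rewrite (_ : A0 `\` _ = set0) ?mass0//.
  by rewrite -subset0 => x [Ax]; apply; exact: sub_saturation.
- by move=> A _; rewrite oppr_le0 mass_ge0.
have {}minA B : competitor A0 B -> mass A <= mass B + delta.
  by move=> /minA; lra.
have [mA _ nA _] := compA.
suff : eps / 4 <= 0 by move: eps0; lra.
apply: (fincomp_limsup mA nA) => eta eta0.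
have eta'0 : 0 < Num.min (eps / 8) (eta / 4) by rewrite lt_min !divr_gt0.
have [U [K [hU hK fK le1 le2]]] := spread mA0 degA0 delta0 compA minA eta'0.
have min1 : Num.min (eps / 8) (eta / 4) <= eps / 8 by rewrite ge_min lexx.
have min2 : Num.min (eps / 8) (eta / 4) <= eta / 4 by rewrite ge_min lexx orbT.
exists U, K; split=> //; last by apply: le_trans le2 _; move: min2; lra.
apply: le_trans le1; rewrite -/N; have := h _ compA.
move: min1 deltaE; lra.
Qed.

End small_section.

(** * The two equivalences *)

Section sections.
Context {d : measure_display} {X : measurableType d} {R : realType}.
Variables (mu : probability X R).
Variables (e : X -> nat -> bool) (G : set (X * X)) (f : nat -> X -> X).
Hypothesis ecoding : coding e.
Hypothesis hG : borel_graph G.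
Hypothesis hlf : locally_finite G.
Hypothesis fmoves : moves G f.
Implicit Types A B K : set X.
Local Notation mass := (mass mu).
Local Notation almost_finite := (almost_finite mu G).
Local Notation nowhere := (nowhere mu G).
Local Notation sat := (saturation G setT).

Let Gsym x y : G (x, y) -> G (y, x). Proof. by case: hG => _ _; apply. Qed.

Let msat' B : measurable B -> measurable (sat B).
Proof. by move=> mB; exact: (measurable_saturation fmoves). Qed.

(** Each point is isolated from its neighbours by a cylinder, so X is covered
    by countably many Borel independent sets.  Keeping in each class the
    first of them that meets it gives an independent set, as adjacent points
    are in the same class. *)
Lemma independent_complete_section : exists M,
  [/\ measurable M, forall x, sat M x & forall x y, M x -> M y -> ~ G (x, y)].
Proof.
have [_ Girr _] := hG.
pose V n := e @^-1` cyl (odflt [::] (@pickle_inv (seq bool) n)).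
have mV n : measurable (V n) by apply/(measurable_code_preimage ecoding)/borelC_cyl.
pose I n := V n `&` ~` has_nbr_in G (V n).
have mI n : measurable (I n).
  by apply: measurableI => //; apply: measurableC; exact: (measurable_has_nbr_in ecoding hG).
have coverI x : exists n, I n x.
  have [k hk] : exists k, forall y, G (x, y) -> ~ agree k (e y) (e x).
    apply: (@finite_uniform _ [set y | G (x, y)] (fun k y => ~ agree k (e y) (e x))) => //.
      by move=> k l t kl; apply: contra_not => /(agree_le kl).
    move=> y /= Gxy; apply/existsNP => ag; apply: (Girr x).
    rewrite -[in X in G (_, X)](_ : y = x)//; apply: (coding_inj ecoding).
    by apply/funext => i; rewrite (ag i.+1).
  exists (pickle (mkseq (e x) k)); rewrite /I /V pickleK_inv /=; split.
    by rewrite /preimage /cyl /= size_mkseq.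
  move=> [y [Gxy]]; rewrite /preimage /cyl /= size_mkseq => /mkseq_agree.
  exact: hk.
pose M := [set x | exists n, (I n `&` [set x | forall m, (m < n)%N -> (~` sat (I m)) x]) x].
exists M; split.
- apply: measurable_exists => n; apply: measurableI => //; apply: measurable_forall => m.
  apply: measurable_imply; first exact: measurable_prop.
  by apply: measurableC; exact: msat'.
- move=> x; have [|n [y Iy xy] nmin] := @first_index (fun n => sat (I n) x).
    by have [n In] := coverI x; exists n; exact: sub_saturation.
  exists y => //; exists n; split=> // m mn nm; apply: (nmin m mn).
  exact: (saturation_rel Gsym (induced_rel_sym Gsym xy)).
- move=> x y [n [In nmin]] [m [Im mmin]] Gxy.
  have xy : induced_rel G setT (x, y) by exact: induced_rel_edge.
  have yx := induced_rel_sym Gsym xy.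
  have [nm|mn|emn] := ltngtP n m.
  + by apply: (mmin _ nm); exists x.
  + by apply: (nmin _ mn); exists y.
  + by case: In => Vx; apply; exists y; split=> //; case: Im; rewrite emn.
Qed.

Lemma almost_finite_section A (eps : R) : measurable A -> mass A = 1 ->
  almost_finite A -> 0 < eps ->
  exists K, [/\ measurable K, forall x, sat K x, 1 - eps < mass K & fincomp G K].
Proof.
move=> mA A1 hA eps0; have [K [mK KA fK ltK]] := hA _ eps0.
have [M [mM satM indM]] := independent_complete_section.
have mKM : measurable (K `|` (M `\` sat K)).
  by apply: measurableU => //; apply: measurableD => //; exact: msat'.
exists (K `|` (M `\` sat K)); split=> //.
- move=> x; have [[y Ky xy]|nK] := pselect (sat K x); first by exists y => //; left.
  have [y My xy] := satM x; exists y => //; right; split=> // Ky; apply: nK.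
  exact: (saturation_rel Gsym (induced_rel_sym Gsym xy)).
- have : mass K <= mass (K `|` (M `\` sat K)) by apply: le_mass => // x; left.
  have := mass_split mu mA mK; rewrite (_ : A `&` K = K); last first.
    by apply/seteqP; split=> [x []//|x Kx]; split=> //; exact: KA.
  move: ltK; rewrite A1; lra.
- apply: (fincompU Gsym) => //.
    move=> x [Mx _]; apply: (sub_finite_set (B := [set x])); last exact: finite_set1.
    move=> y /= xy; apply: (@induced_rel_ind _ _ G _ (fun y => y = x) _ _ _ xy) => //.
    by move=> u v [Mu _] [Mv _] /(indM _ _ Mu Mv).
  move=> x y Kx [_ nK] Gxy; apply: nK; exists x => //.
  by apply: induced_rel_edge => //; exact: Gsym.
Qed.

Hypothesis pmpG : invariant_measure mu (induced_rel G setT).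

(** If B is hyperfinite of positive measure, some partial injection maps a
    positive part of B into the complete section A, and hyperfiniteness
    passes to the image. *)
Lemma nowhere_section A : measurable A -> (forall x, sat A x) -> nowhere A ->
  nowhere setT.
Proof.
move=> mA satA /nowhereP nA; apply/nowhereP => B mB _ hB.
have mw n : measurable_fun setT (word f setT n) by exact: (measurable_word fmoves).
pose S n := pinj f setT n `&` [set x | A (word f setT (ndecode n).1 x)].
have mS n : measurable (S n).
  apply: measurableI; first exact: (measurable_pinj ecoding fmoves).
  exact: measurable_preimage.
apply/eqP; rewrite eq_le mass_ge0 andbT leNgt; apply/negP => B0.
have BS : B `<=` \bigcup_n S n.
  move=> x _; have [y Ay /(pinjP Gsym fmoves)[n nx xy]] := satA x.
  by exists n => //; split=> //=; rewrite xy.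
have [n] := mass_gt0_bigcup mS mB BS B0; apply/negP; rewrite -leNgt.
have mD : measurable (B `&` S n) by exact: measurableI.
have Dn : B `&` S n `<=` pinj f setT n by move=> x [_ []].
rewrite -(mass_pinj_image ecoding fmoves pmpG measurableT mD Dn).
set C := pinj_image _ _ _ _.
have mC : measurable C by exact: (measurable_pinj_image ecoding fmoves).
have CA : C `<=` A by move=> y [_ [[_ [_ Ay]] /= <-]].
rewrite (nA C mC CA)//.
apply: (hyperfinite_pullback (h := word f setT (ndecode (n)).2) mC _ _ _ _ _ hB).
- exact: (borel_equivalence_restr ecoding Gsym fmoves).
- exact: mw.
- by move=> y [_ [[By _] _]].
- by move=> y z /set_mem[_ [_ /= yy]] /set_mem[_ [_ /= zz]] yz; rewrite -yy -zz yz.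
- move=> x y [xy [Cx Cy]]; split; last first.
    by split; [case: Cx => _ [[]]|case: Cy => _ [[]]].
  have wR z : induced_rel G setT (z, word f setT (ndecode n).2 z) by exact: (word_rel fmoves).
  apply: induced_rel_trans (induced_rel_sym Gsym (wR x)) _.
  by apply: induced_rel_trans (wR y); apply: induced_relS xy.
Qed.

(** X is the increasing union of the sets XD of points whose neighbours are
    among the first D moves.  The saturations of the nowhere hyperfinite
    parts of the XD cover almost everything, since outside them X would be
    almost finite; sections of small measure are taken in each of these
    parts, and a null set is added to meet the remaining classes. *)
Lemma nowhere_small_section (eps : R) : nowhere setT -> 0 < eps ->
  exists A, [/\ measurable A, forall x, sat A x, mass A < eps & nowhere A].
Proof.
move=> nG eps0; have [mf fG Gf] := fmoves.
pose XD D := [set x | forall j, exists i : 'I_D, f i x = f j x].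
have mXD D : measurable (XD D).
  apply: measurable_forall => j; apply: measurable_exists => i.
  exact: (measurable_eq_fun ecoding).
have ndXD D : XD D `<=` XD D.+1.
  by move=> x h j; have [i ij] := h j; exists (widen_ord (leqnSn D) i).
have coverXD x : exists D, XD D x.
  have [D hD] : exists D, forall y, [set f j x | j in setT] y -> exists2 i, (i < D)%N & f i x = y.
    apply: (@finite_uniform _ _ (fun D y => exists2 i, (i < D)%N & f i x = y)).
    - apply: (sub_finite_set (B := [set y | G (x, y)] `|` [set x])).
        by move=> _ [j _ <-]; case: (fG j x); [right|left].
      by rewrite finite_setU; split; [exact: hlf|exact: finite_set1].
    - by move=> k l y kl [i ik iy]; exists i => //; exact: leq_trans kl.
    - by move=> _ [j _ <-]; exists j.+1; exists j.
  exists D => j; have [|i iD ij] := hD (f j x); first by exists j.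
  by exists (Ordinal iD).
have /choice[B hB] D := nowhere_decomposition mu ecoding Gsym hlf fmoves (mXD D).
have mB D : measurable (B D) by case: (hB D).
pose Y D := XD D `\` B D.
have mY D : measurable (Y D) by exact: measurableD.
have eps20 : 0 < eps / 2 by rewrite divr_gt0.
have /choice[A hA] D : exists A, competitor mu G (Y D) A /\
    mass A < eps / 2 / (2 ^ D.+1)%:R.
  apply: (@small_section _ _ _ mu e G f ecoding Gsym hlf fmoves pmpG nG (Y D) D) => //.
  - move=> x y [Xx _] _ /Gf[j <-]; have [i ij] := Xx j; exists i => //.
  - by case: (hB D).
  - by rewrite divr_gt0// ltr0n expn_gt0.
have mA D : measurable (A D) by case: (hA D) => -[].
set A' := \bigcup_D A D; have mA' : measurable A' by exact: bigcupT_measurable.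
have mnA' : measurable (~` sat A') by apply: measurableC; exact: msat'.
have satC S : saturated G setT (~` sat S).
  move=> x y nx _ Gxy; apply: contra_not nx; apply: (saturation_rel Gsym).
  by apply: induced_rel_edge => //; exact: Gsym.
have null : mass (~` sat A') = 0.
  pose Z := ~` (\bigcup_D sat (Y D)).
  have mZ : measurable Z by apply/measurableC/bigcupT_measurable => D; exact: msat'.
  have Z0 : mass Z = 0.
    apply: (nowhere_almost_finite ecoding Gsym fmoves pmpG (A := setT)) => //.
      move=> x y nx _ Gxy [D _ Dy]; apply: nx; exists D => //.
      apply: (saturation_rel Gsym) Dy.
      by apply: induced_rel_edge => //; exact: Gsym.
    have -> : Z = \bigcup_D (Z `&` XD D).
      apply/seteqP; split=> [x Zx|x [D _ []]//].
      by have [D XDx] := coverXD x; exists D.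
    apply: almost_finite_bigcup => [D|D x [Zx /ndXD]//|D]; first exact: measurableI.
    have [_ _ _ hBD _] := hB D.
    apply: (almost_finiteS (mB D) _ _ hBD); first exact: measurableI.
    move=> x [Zx Xx]; apply: contrapT => nB; apply: Zx; exists D => //.
    by apply: sub_saturation.
  have mYA D : measurable (Y D `\` sat (A D)) by apply: measurableD => //; exact: msat'.
  have YA0 D : mass (sat (Y D `\` sat (A D))) = 0.
    by apply: (saturation_null ecoding Gsym fmoves pmpG) => //; case: (hA D) => -[].
  have mU : measurable (\bigcup_D sat (Y D `\` sat (A D))).
    by apply: bigcupT_measurable => D; exact: msat'.
  have U0 : mass (\bigcup_D sat (Y D `\` sat (A D))) = 0.
    by apply: mass_bigcup0 => // D; exact: msat'.
  apply/eqP; rewrite eq_le mass_ge0 andbT -[leRHS]addr0 -{1}Z0 -U0.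
  apply: le_massU => // x nx.
  have [[D _ [y Yy xy]]|] := pselect ((\bigcup_D sat (Y D)) x); last by left.
  right; exists D => //; exists y => //; split=> // -[z Az yz]; apply: nx.
  by exists z; [exists D|exact: induced_rel_trans yz].
have massA' : mass A' <= eps / 2.
  by apply: mass_bigcup_le => // [|D]; [exact: ltW|case: (hA D) => _ /ltW].
exists (A' `|` ~` sat A'); split.
- exact: measurableU.
- move=> x; have [[y Ay xy]|nx] := pselect (sat A' x); first by exists y => //; left.
  by apply: sub_saturation => //; right.
- apply: le_lt_trans (massUle _ mA' mnA') _; rewrite null; lra.
- apply: (nowhereU ecoding Gsym fmoves) => //; last exact: nowhere_null.
  by apply: (nowhere_bigcup ecoding Gsym fmoves) => // D; case: (hA D) => -[].
Qed.

End sections.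

Local Open Scope ereal_scope.

Theorem theorem9 (R : realType) (d : measure_display) (X : measurableType d)
    (mu : probability X R) (G : set (X * X))
    (hX : standard_borel R X) (hG : borel_graph G)
    (hlf : locally_finite G) (hpmp : pmp mu G) :
  (mu_hyperfinite mu G <->
   forall eps : R, (0 < eps)%R ->
     exists A : set X,
       [/\ measurable A, complete_section (conn_rel setT G) A,
           (1 - eps)%:E < mu A & finite_components A (restr G A)])
  /\
  (nowhere_hyperfinite mu setT G <->
   forall eps : R, (0 < eps)%R ->
     exists A : set X,
       [/\ measurable A, complete_section (conn_rel setT G) A,
           mu A < eps%:E & nowhere_hyperfinite mu A (restr G A)]).
Proof.
have [_ _ Gsym] := hG.
have [e ecoding] := standard_borel_coding hX.
have [f fmoves] := moves_exist ecoding hG hlf.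
have RE := induced_rel_setT G.
have pmpG : invariant_measure mu (induced_rel G setT) by rewrite RE.
have nE : nowhere_hyperfinite mu setT G = nowhere mu G setT.
  by rewrite /nowhere /restr setXTT setIT.
have secE A : complete_section (conn_rel setT G) A <-> forall x, saturation G setT A x.
  by rewrite -RE.
split; split.
- move=> [X0 [mX0 X00 hX0]] eps eps0.
  have X1 : mass mu X0 = 1%R.
    have := mass_split mu measurableT mX0; rewrite setTI setTD massT.
    by rewrite {2}/mass X00 /= addr0.
  have hA : almost_finite mu G X0.
    rewrite (_ : X0 = saturation G X0 X0); last first.
      by apply/seteqP; split; [exact: sub_saturation|exact: saturation_sub].
    apply: (hyperfinite_almost_finite mu ecoding Gsym hlf fmoves) => //.
    rewrite (_ : restr _ _ = induced_rel G X0)//.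
    apply/seteqP; split=> [p []//|[x y] xy]; split=> //.
    exact: induced_rel_sub xy.
  have [K [mK satK ltK fK]] := almost_finite_section ecoding hG hlf fmoves mX0 X1 hA eps0.
  by exists K; split=> //; [exact/secE|rewrite massE// lte_fin].
- move=> h; have hT : almost_finite mu G setT.
    move=> eps eps0; have [A [mA _ + fA]] := h _ eps0.
    rewrite massE// lte_fin => ltA; exists A; split=> //.
    have := mass_split mu measurableT mA; rewrite setTI massT; lra.
  have [B [mB _ B0 hB]] := almost_finite_hyperfinite ecoding Gsym fmoves measurableT hT.
  exists B; split=> //; rewrite massE; last exact: measurableC.
  by rewrite -setTD B0.
- rewrite nE => nG eps eps0.
  have [A [mA satA ltA nA]] := nowhere_small_section ecoding hG hlf fmoves pmpG nG eps0.
  by exists A; split=> //; [exact/secE|rewrite massE// lte_fin].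
- move=> /(_ 1%R ltr01)[A [mA /secE satA _ nA]]; rewrite nE.
  exact: (nowhere_section ecoding hG fmoves pmpG mA satA).
Qed.
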